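(* Let $X$ be a finite-dimensional compact metric space, $Y\subseteq X$ compact, and $\mathcal U\subset C^0(X,X)$ a set of homeomorphisms that is uniformly h-expansive on $Y$. Let $f\in\mathcal U$ and $\mu$ an $f$-invariant Borel probability with $\operatorname{supp}\mu\subset Y$. Then for every $\varepsilon>0$ there are an open set $\mathcal V\ni f$ in $C^0(X,X)$ and an open set $U\ni\mu$ in $\mathcal P(Y)$ such that for every $g\in\mathcal U\cap\mathcal V$ and every $g$-invariant $\nu\in U\cap\mathcal P(Y)$, $$h_\nu(g)\le h_\mu(f)+\varepsilon.$$
   Context: Finite-dimensional means of finite covering (Lebesgue) dimension. $C^0(X,X)$ has the uniform topology; $\mathcal P(Y)$ is the space of Borel probabilities on $Y$ with the weak* topology; $h_\nu(g)$ is the Kolmogorov–Sinai metric entropy. For a homeomorphism $f$, $\varepsilon>0$ and $x\in X$, $\Gamma_\varepsilon(x,f)=\{y\in X: d(f^n(y),f^n(x))\le\varepsilon\ \forall n\in\mathbb Z\}$. For a compact $K\subset X$, $h_{top}(K,f)=\lim_{\delta\to0}\limsup_{n\to\infty}\frac1n\log r(K,n,\delta)$, where $r(K,n,\delta)$ is the minimal cardinality of a set $E\subset X$ such that every $y\in K$ has some $e\in E$ with $d(f^j(y),f^j(e))\le\delta$ for $0\le j<n$. A set $\mathcal U$ of homeomorphisms is uniformly h-expansive on $Y$ if there is $\varepsilon>0$ such that $h_{top}(\Gamma_\varepsilon(y,f),f)=0$ for all $f\in\mathcal U$ and all $y\in Y$. *)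

(* Defs.v *)
From HB Require Import structures.
From mathcomp Require Import all_boot all_order all_algebra.
From mathcomp Require Import all_classical all_reals all_analysis.
Set Implicit Arguments. Unset Strict Implicit. Unset Printing Implicit Defensive.
Import Order.TTheory GRing.Theory Num.Theory numFieldNormedType.Exports.
Local Open Scope classical_set_scope.
Local Open Scope ring_scope.

(** metric spaces with a distinguished point (needed by the library's
    generated sigma-algebra; harmless since X carries a probability). *)
#[short(type="pmetricType")]
HB.structure Definition PointedMetric (K : numDomainType) :=
  { M of Pointed M & Metric K M }.

Section Defs.
Context {R : realType} {X : pmetricType R}.

Definition borel := g_sigma_algebraType (@open X).

Definition dist (x y : X) : R := mdist x y.

Definition covering_dim_le (n : nat) : Prop :=
  forall (k : nat) (C : nat -> set X),
    (forall i, (i < k)%N -> open (C i)) ->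
    (forall x, exists2 i, (i < k)%N & C i x) ->
    exists (m : nat) (V : nat -> set X),
      [/\ forall j, (j < m)%N -> open (V j),
          forall x, exists2 j, (j < m)%N & V j x,
          forall j, (j < m)%N -> exists2 i, (i < k)%N & V j `<=` C i
        & forall x, (count (fun j => `[< V j x >]) (iota 0 m) <= n.+1)%N].

Definition finite_dimensional : Prop := exists n, covering_dim_le n.

Definition is_homeo (g : X -> X) : Prop :=
  continuous g /\ exists h : X -> X,
    [/\ continuous h, cancel g h & cancel h g].

(** Γ_ε(x,f) = {y | d(f^n y, f^n x) <= ε for all n ∈ ℤ}.  For a bijection f,
    the negative iterate f^{-n}(z) is the unique u with f^n u = z; we write
    the condition for negative n in that (literal) form. *)
Definition Gamma (eps : R) (x : X) (f : X -> X) : set X :=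
  [set y | (forall n : nat, dist (iter n f y) (iter n f x) <= eps) /\
           (forall (n : nat) (u v : X), iter n f u = y -> iter n f v = x ->
               dist u v <= eps)].

Definition spans (f : X -> X) (K : set X) (n : nat) (delta : R) (E : seq X) :=
  forall y, K y -> exists2 e, e \in E &
    forall j, (j < n)%N -> dist (iter j f y) (iter j f e) <= delta.

Definition rspan (f : X -> X) (K : set X) (n : nat) (delta : R) : \bar R :=
  ereal_inf [set ((size (undup E))%:R)%:E | E in spans f K n delta].

Definition htop_set (K : set X) (f : X -> X) : \bar R :=
  lim ((fun delta : R =>
         limn_esup (fun n : nat =>
           ((n%:R)^-1 * ln (fine (rspan f K n delta)))%:E)) @ 0^'+).

Definition uniformly_h_expansive (U : set (X -> X)) (Y : set X) : Prop :=
  exists2 eps : R, 0 < eps &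
    forall f, U f -> forall y, Y y -> htop_set (Gamma eps y f) f = 0%E.

Definition f_invariant (g : X -> X) (mu : probability borel R) : Prop :=
  forall A : set borel, measurable A -> mu (g @^-1` A) = mu A.

Definition msupport (mu : probability borel R) : set X :=
  [set x | forall U : set X, open U -> U x -> (0 < mu U)%E].

Definition finite_partition (xi : seq (set X)) : Prop :=
  [/\ forall i, (i < size xi)%N -> measurable ((nth set0 xi i) : set borel),
      forall i j, (i < size xi)%N -> (j < size xi)%N -> i <> j ->
        (nth set0 xi i) `&` (nth set0 xi j) = set0
    & \bigcup_(i in [set i | (i < size xi)%N]) (nth set0 xi i) = setT].

Definition entropy_fun (t : R) : R := - (t * ln t).

Definition join_entropy (mu : probability borel R) (g : X -> X)
    (xi : seq (set X)) (n : nat) : R :=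
  \sum_(k : {ffun 'I_n -> 'I_(size xi)})
     entropy_fun (fine (mu (\bigcap_(i in [set: 'I_n])
                               (iter i g @^-1` nth set0 xi (k i)) : set borel))).

Definition entropy_partition (mu : probability borel R) (g : X -> X)
    (xi : seq (set X)) : R :=
  limn (fun n : nat => (n%:R)^-1 * join_entropy mu g xi n).

Definition ks_entropy (mu : probability borel R) (g : X -> X) : \bar R :=
  ereal_sup [set (entropy_partition mu g xi)%:E | xi in finite_partition].

Definition integ (mu : probability borel R) (Y : set X) (phi : X -> R) : \bar R :=
  (\int[mu]_(x in (Y : set borel)) (phi x)%:E)%E.

End Defs.

Arguments borel {R} X.
Arguments covering_dim_le {R} X n.
Arguments finite_dimensional {R} X.

(* Main.v *)
Require Import Defs.
From HB Require Import structures.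
From mathcomp Require Import all_boot all_order all_algebra.
From mathcomp Require Import all_classical all_reals all_analysis.
From mathcomp Require Import measurable_realfun ring lra.
Import Order.TTheory GRing.Theory Num.Theory numFieldNormedType.Exports.
Local Open Scope classical_set_scope.
Local Open Scope ring_scope.

(**
Let e be the expansivity constant.  For g in U and a g-invariant nu supported in
Y, a finite partition a of diameter at most e computes the entropy: by Bowen's
argument, zero entropy of the sets Gamma_e(y, g) and compactness of the support
give, for every beta > 0, a cover of each Bowen ball of radius e and length n by
at most c exp(beta n) sets that are close along n iterates.  Given any other
partition b, shrink its cells to closed cores filling all but a small mass; sets
that are close enough visit at most one core at each time.  So the b-word of a
point is determined by its a-word, by one of c exp(beta n) choices, and by its
letters at the rare times outside the cores.  The Gibbs inequality
H(P) <= H(Q) + E(- ln w(P | Q)), applied to a kernel w that encodes this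
description, yields H_n(b) <= H_n(a) + ln c + n beta' with beta' as small as
desired.

It remains to bound H_n / n at a single time n, chosen so that H_n(mu, f) / n is
close to its infimum h_mu(f, a).  Thickening closed cores of the cells of a gives
a partition a' of diameter at most e whose n-cells have, for every (g, nu) close
to (f, mu), mass at least that of the n-cells of a under (f, mu) up to a small
error, as tested by one continuous function per cell.  As both mass vectors sum
to one, the lower bounds alone make the two entropies close.
*)

(** * Finite entropy inequalities *)

Lemma entropy_fun_ge0 {R : realType} (t : R) : 0 <= t -> t <= 1 -> 0 <= entropy_fun t.
Proof.
by move=> t0 t1; rewrite /entropy_fun -mulrN mulr_ge0// oppr_ge0 ln_le0.
Qed.

(** The tangent line bound ln x <= x - 1 at x = a w / p, multiplied by p; at p = 0 the left side
    vanishes. *)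
Lemma gibbs_term {R : realType} (p a w : R) :
  0 <= p -> 0 <= a -> 0 <= w -> (0 < p -> 0 < a) -> (0 < p -> 0 < w) ->
  p * (ln a + ln w - ln p) <= a * w - p.
Proof.
move=> p0 a0 w0 pa pw; have [->|pN0] := eqVneq p 0.
  by rewrite mul0r subr0 mulr_ge0.
have pp : 0 < p by rewrite lt_neqAle eq_sym pN0.
have ap := pa pp; have wp := pw pp.
have xp : 0 < a * w / p by rewrite divr_gt0// mulr_gt0.
rewrite -lnM ?posrE// -ln_div ?posrE ?mulr_gt0//.
have -> : a * w - p = p * (a * w / p - 1).
  by rewrite mulrBr mulr1 mulrCA divff// mulr1.
rewrite ler_pM2l// -[in leLHS](subrK 1 (a * w / p)) addrC.
by apply: le_ln1Dx; lra.
Qed.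

(** On each fibre of [psi] the weights [w] form a subprobability, a guess for the law of t given
    [psi t]. The entropy of [phi] is at most that of [pi], which is the entropy of [psi] plus a
    conditional entropy, and the mean of - ln w under any such guess bounds the latter from
    above. *)
Lemma gibbs {R : realType} {T P Q : finType} (pi w : T -> R) (phi : T -> P) (psi : T -> Q) :
  (forall t, 0 <= pi t) -> (forall t, 0 <= w t) -> (forall t, 0 < pi t -> 0 < w t) ->
  (forall q, \sum_(t | psi t == q) w t <= 1) ->
  \sum_p entropy_fun (\sum_(t | phi t == p) pi t) <=
  \sum_q entropy_fun (\sum_(t | psi t == q) pi t) + \sum_t pi t * - ln (w t).
Proof.
move=> pi0 w0 piw w1.
have margE (I : finType) (h : T -> I) :
    \sum_i entropy_fun (\sum_(t | h t == i) pi t) =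
    \sum_t pi t * - ln (\sum_(s | h s == h t) pi s).
  rewrite (partition_big h xpredT)//=; apply: eq_bigr => i _.
  rewrite /entropy_fun -mulrN mulr_suml; apply: eq_bigr => t /eqP <- //.
have marg (I : finType) (h : T -> I) t : pi t <= \sum_(s | h s == h t) pi s.
  by rewrite (bigD1 t)//= lerDl sumr_ge0.
rewrite !margE.
apply: (@le_trans _ _ (\sum_t pi t * - ln (pi t))).
  apply: ler_sum => t _; have := pi0 t; rewrite le_eqVlt => /predU1P[<-|pt].
    by rewrite !mul0r.
  by rewrite ler_pM2l// lerN2 ler_ln ?posrE// (lt_le_trans pt).
rewrite -subr_le0 opprD addrA -!sumrB.
(* Termwise [gibbs_term] with p = pi t and a the mass of the fibre of t. The new sum is nonpositive
   since [w] has mass at most 1 on each fibre. *)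
apply: (@le_trans _ _ (\sum_t ((\sum_(s | psi s == psi t) pi s) * w t - pi t))).
  apply: ler_sum => t _.
  apply: le_trans (gibbs_term _ (\sum_(s | psi s == psi t) pi s) (w t) _ _ _ _ _) => //.
  - by rewrite le_eqVlt; apply/orP; left; apply/eqP; rewrite -!mulrBr; congr (_ * _); lra.
  - exact: sumr_ge0.
  - by move=> pt; exact: lt_le_trans pt (marg _ _ _).
  - exact: piw.
rewrite sumrB subr_le0 (partition_big psi xpredT)//=.
rewrite [leRHS](partition_big psi xpredT)//=; apply: ler_sum => q _.
rewrite -[leRHS]mulr1; under eq_bigr => t /eqP -> do over.
by rewrite -mulr_sumr ler_wpM2l// sumr_ge0.
Qed.

(** Euclidean division of n by a fixed m for which [v m] is almost the infimum. The value [u 0] may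
    be positive and stays in the error. *)
Lemma fekete {R : realType} (u : nat -> R) :
  (forall n, 0 <= u n) -> (forall m n, u (m + n)%N <= u m + u n) ->
  cvgn (fun n => n%:R^-1 * u n) /\
  forall n, (0 < n)%N -> limn (fun n => n%:R^-1 * u n) <= n%:R^-1 * u n.
Proof.
move=> u0 usub.
pose v n := n%:R^-1 * u n.
pose S : set R := [set v n | n in [set n | (0 < n)%N]].
have Slb : has_lbound S by exists 0 => _ [n _ <-]; rewrite mulr_ge0 ?invr_ge0.
have Sinf : has_inf S by split => //; exists (v 1%N); exists 1%N.
have uM m q : u (q * m)%N <= q%:R * u m + u 0%N.
  elim: q => [|q ih]; first by rewrite mul0n mul0r add0r.
  rewrite mulSn (le_trans (usub _ _))// -natr1; lra.
have uL r : u r <= r%:R * u 1%N + u 0%N by have := uM 1%N r; rewrite muln1.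
suff vl : v @ \oo --> inf S.
  have vE : limn v = inf S by apply/cvg_lim.
  split; first by apply/cvg_ex; exists (inf S).
  by move=> n n0; rewrite -/v vE; apply: ge_inf => //; exists n.
apply/cvgrPdist_le => e e0.
have [_ [m /= m0 <-] vm] := inf_adherent (divr_gt0 e0 (ltr0n R 2)) Sinf.
(* Bounds, independently of n, the remainder term u r with r < m and the leftover copies of
   [u 0]. *)
pose c := m%:R * u 1%N + u 0%N + u 0%N.
have c0 : 0 <= c by rewrite /c !addr_ge0 ?mulr_ge0.
have mR : 0 < m%:R :> R by rewrite ltr0n.
near=> n.
have n0 : (0 < n)%N by near: n; exists 1%N.
have nR : 0 < n%:R :> R by rewrite ltr0n.
have lev : inf S <= v n by apply: ge_inf => //; exists n.
rewrite distrC ger0_norm ?subr_ge0// lerBlDr.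
have -> : e + inf S = e / 2 + (e / 2 + inf S) by lra.
have cn : c / n%:R <= e / 2.
  rewrite ler_pdivrMr// mulrC -ler_pdivrMr ?divr_gt0//.
  near: n; exact: nbhs_infty_ger.
suff : v n <= c / n%:R + v m by lra.
rewrite /v [leLHS]mulrC ler_pdivrMr// mulrDl divfK ?gt_eqF//.
rewrite {1}(divn_eq n m) (le_trans (usub _ _))// addrC.
have h1 := uM m (n %/ m)%N; have h2 := uL (n %% m)%N.
have h3 : (n %% m)%:R * u 1%N <= m%:R * u 1%N.
  by rewrite ler_wpM2r// ler_nat ltnW// ltn_mod.
have h4 : (n %/ m)%:R * u m <= m%:R^-1 * u m * n%:R.
  rewrite mulrAC ler_wpM2r// mulrC ler_pdivlMr// -natrM ler_nat leq_trunc_div//.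
rewrite /c; lra.
Unshelve. all: by end_near.
Qed.

(* Lower bounds suffice: both vectors sum to 1, so they force q <= p + #|T| kap. *)
Lemma entropy_lower_close {R : realType} {T : finType} (p : T -> R) (e : R) :
  (forall t, 0 <= p t) -> \sum_t p t = 1 -> 0 < e ->
  exists2 kap : R, 0 < kap & forall q : T -> R,
    (forall t, 0 <= q t) -> \sum_t q t = 1 -> (forall t, p t - kap <= q t) ->
    \sum_t entropy_fun (q t) <= \sum_t entropy_fun (p t) + e.
Proof.
move=> p0 p1 e0.
pose N : R := #|T|%:R; have N0 : 0 <= N by [].
pose Z := expR (e / 2).
have Z1 : 1 < Z by rewrite /Z expR_gt1 divr_gt0.
pose th := (Z - 1) / (N + 1).
have N1 : 0 < N + 1 by lra.
have th0 : 0 < th by rewrite divr_gt0// subr_gt0.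
have thZ : N * th <= Z - 1.
  by rewrite /th mulrA ler_pdivrMr//; nra.
pose L := `|ln (th / Z)|.
have L0 : 0 <= L by exact: normr_ge0.
pose kap := e / 2 / ((N + 1) * (N + 1) * (L + 1)).
have kap0 : 0 < kap by rewrite !divr_gt0// !mulr_gt0//; lra.
exists kap => // q q0 q1 pq.
have qp t : q t <= p t + N * kap.
  have h : \sum_(s | s != t) (p s - kap) <= \sum_(s | s != t) q s by exact: ler_sum.
  move: p1 q1; rewrite (bigD1 t)//= [in X in _ -> X](bigD1 t)//=.
  have : \sum_(s | s != t) kap <= N * kap.
    rewrite sumr_const -mulr_natl ler_pM2r// ler_nat; exact: max_card.
  move: h; rewrite sumrB; lra.
(* A smoothing of p: adding [th] keeps - ln w below [L] even where p vanishes, and dividing by Z =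
   exp(e / 2) brings the total mass to at most 1 at a cost of e / 2. *)
pose w t := (p t + th) / Z.
have Z0 : 0 < Z by lra.
have w0 t : 0 < w t by rewrite divr_gt0//; have := p0 t; lra.
have id_sum (r : T -> R) : \sum_t entropy_fun (\sum_(s | s == t) r s) = \sum_t entropy_fun (r t).
  by apply: eq_bigr => t _; rewrite big_pred1_eq.
have w1 : \sum_t w t <= 1.
  rewrite -mulr_suml big_split/= p1 sumr_const -[X in _ + X]mulr_natl -/N.
  by rewrite ler_pdivrMr//; lra.
have wle1 t : w t <= 1.
  by apply: le_trans w1; rewrite (bigD1 t)//= lerDl sumr_ge0// => s _; exact/ltW.
(* With a constant [psi] and total mass 1 the coarse entropy is 0, so the entropy of q is at most
   the q-mean of - ln w. *)
have := @gibbs _ _ _ unit q w id (fun=> tt) q0 (fun t => ltW (w0 t)) (fun t _ => w0 t).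
rewrite (id_sum q) (bigD1 tt)//= [\sum_(i | i != tt) _]big1; last by case.
rewrite (eq_bigl xpredT)// q1 /entropy_fun ln1 mulr0 oppr0 ?addr0 ?add0r => H.
apply: le_trans (H _) _; first by case; rewrite (eq_bigl xpredT).
have mlw t : - ln (w t) <= L.
  have := ler_norm (- ln (th / Z)).
  rewrite normrN -/L; apply: le_trans.
  by rewrite lerN2 ler_ln ?posrE ?w0 ?(divr_gt0 th0 Z0)// /w ler_pM2r ?invr_gt0//; have := p0 t; lra.
(* As - ln w >= 0, q may be replaced by p + N kap. The p part yields its entropy and e / 2; the rest
   is absorbed by the choice of [kap]. *)
have term t : q t * - ln (w t) <= - (p t * ln (p t)) + p t * (e / 2) + N * kap * L.
  have lw0 : 0 <= - ln (w t) by rewrite oppr_ge0 ln_le0.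
  apply: (@le_trans _ _ ((p t + N * kap) * - ln (w t))); first by rewrite ler_wpM2r.
  rewrite mulrDl lerD//; last by rewrite ler_wpM2l// mulr_ge0// ltW.
  have := p0 t; rewrite le_eqVlt => /predU1P[<-|pt]; first by rewrite !mul0r oppr0 add0r.
  rewrite -mulrN -mulrDr ler_pM2l// lerNl opprD opprK -[e / 2]expRK -/Z -ln_div ?posrE//.
  by rewrite ler_ln ?posrE ?w0 ?(divr_gt0 pt Z0)// /w ler_pM2r ?invr_gt0// lerDl ltW.
apply: le_trans (ler_sum _ (fun t _ => term t)) _.
rewrite !big_split/= -mulr_suml p1 sumr_const -[X in _ + _ + X]mulr_natl -/N.
have : N * (N * kap * L) <= e / 2.
  rewrite /kap; set D := (N + 1) * (N + 1) * (L + 1).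
  have D0 : 0 < D by rewrite !mulr_gt0//; lra.
  have -> : N * (N * (e / 2 / D) * L) = (e / 2) * ((N * N * L) / D).
    by field; rewrite ?gt_eqF//.
  rewrite -[leRHS]mulr1 ler_pM2l ?divr_gt0// ler_pdivrMr// mul1r /D.
  by apply: ler_pM => //; [exact: mulr_ge0|apply: ler_pM => //; lra|lra].
lra.
Qed.

(** * Compact metric spaces *)

Lemma dist_ge0 {R : realType} {X : pmetricType R} (x y : X) : 0 <= dist x y.
Proof. exact: mdist_ge0. Qed.

Lemma distxx {R : realType} {X : pmetricType R} (x : X) : dist x x = 0.
Proof. exact: mdistxx. Qed.

Lemma dist_sym {R : realType} {X : pmetricType R} (x y : X) : dist x y = dist y x.
Proof. exact: metric_sym. Qed.

Lemma dist_triangle {R : realType} {X : pmetricType R} (y x z : X) :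
  dist x z <= dist x y + dist y z.
Proof. exact: metric_triangle. Qed.

Lemma ball_distE {R : realType} {X : pmetricType R} (x : X) (r : R) :
  ball x r = [set y | dist x y < r].
Proof. exact: ballEmdist. Qed.

Lemma open_dist {R : realType} {X : pmetricType R} (A : set X) :
  open A <-> forall x, A x -> exists2 r : R, 0 < r & forall y, dist x y < r -> A y.
Proof.
split=> [oA x Ax|h].
  have /nbhs_ballP[r /= r0 rA] : nbhs x A by exact: open_nbhs_nbhs.
  by exists r => // y xy; apply: rA; rewrite ball_distE.
rewrite openE => x /h[r r0 rA]; apply/nbhs_ballP; exists r => //= y.
by rewrite ball_distE; exact: rA.
Qed.

Lemma closed_dist {R : realType} {X : pmetricType R} (A : set X) :
  closed A <-> forall x, (forall r : R, 0 < r -> exists2 y, A y & dist x y < r) -> A x.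
Proof.
rewrite -openC open_dist; split=> [h x hx|h x nAx].
  apply: contrapT => /h[r r0 rA]; have [y Ay xy] := hx _ r0.
  exact: rA xy Ay.
apply: contrapT => hr; apply/nAx/h => r r0; apply: contrapT => hy.
apply: hr; exists r => // y xy Ay; apply: hy; by exists y.
Qed.

Lemma continuous_dist {R : realType} {X : pmetricType R} (g : X -> X) :
  continuous g <->
  forall x (e : R), 0 < e -> exists2 d : R, 0 < d & forall y, dist x y < d -> dist (g x) (g y) < e.
Proof.
split=> [cg x e e0|h x].
  have : nbhs (g x) (ball (g x) e) by exact: nbhsx_ballx.
  move/(cg x) => /nbhs_ballP[d /= d0 dP]; exists d => // y xy.
  by have := dP y; rewrite /= !ball_distE; apply.
apply/cvg_ballP => e e0; have [d d0 dP] := h x e e0.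
by apply/nbhs_ballP; exists d => //= y; rewrite !ball_distE; exact: dP.
Qed.

Lemma real_continuous_dist {R : realType} {X : pmetricType R} (g : X -> R) :
  (forall x (e : R), 0 < e -> exists2 d : R, 0 < d & forall y, dist x y < d -> `|g x - g y| < e) ->
  continuous g.
Proof.
move=> h x; apply/cvgrPdist_lt => e e0; have [d d0 dP] := h x e e0.
by apply/nbhs_ballP; exists d => //= y; rewrite ball_distE; exact: dP.
Qed.

Lemma continuous_iter {R : realType} {X : pmetricType R} (g : X -> X) n :
  continuous g -> continuous (iter n g).
Proof.
move=> cg; elim: n => [|n ih] x; first exact: cvg_id.
by apply: (@continuous_comp _ _ _ (iter n g) g); [exact: ih|exact: cg].
Qed.

(** Cluster points stand in for convergent subsequences in the compactness arguments by
    contradiction below. *)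
Lemma compact_accumulation {R : realType} {X : pmetricType R} (u : nat -> X) :
  compact [set: X] ->
  exists y, forall (r : R) n, 0 < r -> exists2 m, (n <= m)%N & dist (u m) y < r.
Proof.
move=> cX; have [y [_ cly]] := cX (u @ \oo) _ filterT.
exists y => r n r0.
have [||z [[m /= nm <-]]] := cly (u @` [set m | (n <= m)%N]) (ball y r).
- by exists n => // m /= nm; exists m.
- exact: nbhsx_ballx.
by rewrite ball_distE /= dist_sym => umy; exists m.
Qed.

Lemma compact_finite_net {R : realType} {X : pmetricType R} (d : R) :
  compact [set: X] -> 0 < d -> exists s : seq X, forall x, exists2 c, c \in s & dist c x < d.
Proof.
move=> cX d0; move: cX; rewrite compact_cover => /(_ X setT (fun x => ball x d)).
case=> [x _|x _|s _ hs].
- by rewrite open_dist ball_distE => y /= xy; exists (d - dist x y) => [|z yz];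
    [lra|have := dist_triangle y x z; lra].
- by exists x => //; exact: ballxx.
exists (finmap.enum_fset s) => x; have [c cs] := hs x I; rewrite ball_distE => cx.
by exists c.
Qed.

Lemma invr_nat_lt {R : realType} (e : R) : 0 < e ->
  exists n, forall m, (n <= m)%N -> (m.+1%:R^-1 : R) < e.
Proof.
move=> e0; exists (Num.truncn e^-1) => m nm.
rewrite -[e]invrK ltf_pV2 ?posrE ?invr_gt0//.
by apply: lt_le_trans (truncnS_gt _) _; rewrite ler_nat.
Qed.

(** Otherwise there are pairs from A and B at distance below 1 / (n + 1) for every n, and an
    accumulation point of their first members lies in both closed sets. *)
Lemma closed_separation {R : realType} {X : pmetricType R} (A B : set X) :
  compact [set: X] -> closed A -> closed B -> A `&` B = set0 ->
  exists2 s : R, 0 < s & forall a b, A a -> B b -> s <= dist a b.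
Proof.
move=> cX cA cB AB; apply: contrapT => h.
have [u uP] : {u : nat -> X * X & forall n, [/\ A (u n).1, B (u n).2 &
    dist (u n).1 (u n).2 < (n.+1%:R^-1 : R)]}.
  apply: (@choice _ _ (fun n (p : X * X) => [/\ A p.1, B p.2 & dist p.1 p.2 < (n.+1%:R^-1 : R)])) => n.
  apply: contrapT => hn; apply: h; exists (n.+1%:R^-1 : R); first by rewrite invr_gt0.
  move=> a b Aa Bb; rewrite leNgt; apply/negP => ab; apply: hn; by exists (a, b).
have [y yP] := compact_accumulation (fun n => (u n).1) cX.
suff : (A `&` B) y by rewrite AB.
split.
  move/closed_dist : cA; apply => r r0; have [m _ my] := yP _ 0%N r0.
  by exists (u m).1; [case: (uP m)|rewrite dist_sym].
move/closed_dist : cB; apply => r r0.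
have r2 : 0 < r / 2 by lra.
have [N NP] := invr_nat_lt _ r2.
have [m /NP lm my] := yP _ N r2; rewrite /= in my.
have [_ Bu /lt_trans/(_ lm) uu] := uP m; exists (u m).2 => // {lm}.
have := dist_triangle (u m).1 y (u m).2; rewrite (dist_sym y (u m).1); lra.
Qed.

Lemma compact_uniform_continuity {R : realType} {X : pmetricType R} (g : X -> X) (e : R) :
  compact [set: X] -> continuous g -> 0 < e ->
  exists2 d : R, 0 < d & forall x y, dist x y < d -> dist (g x) (g y) < e.
Proof.
move=> cX /continuous_dist cg e0; apply: contrapT => h.
have [u uP] : {u : nat -> X * X & forall n,
    dist (u n).1 (u n).2 < (n.+1%:R^-1 : R) /\ e <= dist (g (u n).1) (g (u n).2)}.
  apply: (@choice _ _ (fun n (p : X * X) =>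
    dist p.1 p.2 < (n.+1%:R^-1 : R) /\ e <= dist (g p.1) (g p.2))) => n.
  apply: contrapT => hn; apply: h; exists (n.+1%:R^-1 : R); first by rewrite invr_gt0.
  move=> a b ab; rewrite ltNge; apply/negP => gab; apply: hn; by exists (a, b).
have [y yP] := compact_accumulation (fun n => (u n).1) cX.
have e2 : 0 < e / 2 by lra.
have [d d0 dP] := cg y _ e2.
have d2 : 0 < d / 2 by lra.
have [N NP] := invr_nat_lt _ d2.
have [m /NP lm my] := yP _ N d2; rewrite /= in my.
have [/lt_trans/(_ lm) uu gu] := uP m; move=> {lm}.
have t1 := dist_triangle (u m).1 y (u m).2.
have := dP (u m).1; have := dP (u m).2; rewrite !(dist_sym y) in t1 *.
have t2 := dist_triangle (g y) (g (u m).1) (g (u m).2); rewrite (dist_sym (g (u m).1) (g y)) in t2.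
by move=> /(_ ltac:(lra)) ? /(_ ltac:(lra)); lra.
Qed.

(** Induction on n: at the next step g is first compared with f at the point g^i x, then uniform
    continuity of f compares the images of g^i x and f^i x. *)
Lemma iter_perturbation {R : realType} {X : pmetricType R} (f : X -> X) (n : nat) (s : R) :
  compact [set: X] -> continuous f -> 0 < s ->
  exists2 d : R, 0 < d & forall g : X -> X, (forall x, dist (g x) (f x) < d) ->
    forall i x, (i <= n)%N -> dist (iter i g x) (iter i f x) < s.
Proof.
move=> cX cf; elim: n s => [|n ih] s s0.
  by exists 1 => // g _ i x; rewrite leqn0 => /eqP -> /=; rewrite distxx.
have s2 : 0 < s / 2 by lra.
have [d1 d10 d1P] := compact_uniform_continuity _ _ cX cf s2.
have [d2 d20 d2P] := ih (Num.min d1 s) ltac:(by rewrite lt_min d10 s0).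
exists (Num.min d2 (s / 2)); first by rewrite lt_min d20.
move=> g gf; have gf2 x : dist (g x) (f x) < d2 by have := gf x; rewrite lt_min => /andP[].
move=> [|i] x; first by rewrite /= distxx.
rewrite ltnS => ile /=.
have := d2P g gf2 i x ile; rewrite lt_min => /andP[/d1P h _].
have := gf (iter i g x); rewrite lt_min => /andP[_].
have := dist_triangle (f (iter i g x)) (g (iter i g x)) (f (iter i f x)); lra.
Qed.

(** The tent max(0, 1 - D / s), with D the distance to C. An empty C is treated apart, as D is then
    an infimum over nothing. *)
Lemma urysohn_dist {R : realType} {X : pmetricType R} (C : set X) (s : R) : 0 < s ->
  exists phi : X -> R, [/\ continuous phi, forall x, 0 <= phi x <= 1,
    forall x, C x -> phi x = 1 & forall x, 0 < phi x -> exists2 c, C c & dist x c < s].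
Proof.
move=> s0; have [->|C0] := eqVneq C set0.
  exists (fun=> 0); split => //; first by move=> x; exact: cvg_cst.
    by move=> x; rewrite lexx ler01.
  by move=> x; rewrite ltxx.
have /set0P[c0 Cc0] := C0.
pose D x := inf [set dist x c | c in C].
have Dlb x : has_lbound [set dist x c | c in C].
  by exists 0 => _ [c _ <-]; exact: dist_ge0.
have Dinf x : has_inf [set dist x c | c in C].
  by split => //; exists (dist x c0), c0.
have D0 x : 0 <= D x.
  by apply: lb_le_inf => [|_ [c _ <-]]; [exists (dist x c0), c0|exact: dist_ge0].
have Dlip x y : D x <= D y + dist x y.
  rewrite -lerBlDr; apply: lb_le_inf; first by exists (dist y c0), c0.
  move=> _ [c Cc <-]; rewrite lerBlDr; apply: le_trans (_ : dist x c <= _).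
    by apply: ge_inf => //; exists c.
  by rewrite addrC dist_triangle.
pose phi x := Num.max 0 (1 - D x / s).
exists phi; split.
- apply: real_continuous_dist => x e e0; exists (e * s); first exact: mulr_gt0.
  move=> y xy; rewrite /phi.
  have h : `|D x / s - D y / s| < e.
    rewrite -mulrBl normrM (gtr0_norm (x := s^-1)) ?invr_gt0// ltr_pdivrMr//.
    apply: le_lt_trans xy; rewrite ler_norml; have := Dlip x y; have := Dlip y x.
    rewrite (dist_sym y); lra.
  move: (D x / s) (D y / s) h => a b; rewrite !ltr_norml !maxEle => /andP[h1 h2].
  by apply/andP; split; case: (leP 0 (1 - a)) => ?; case: (leP 0 (1 - b)) => ?; lra.
- move=> x; rewrite le_max lexx/= ge_max ler01/=.
  have : 0 <= D x / s by rewrite divr_ge0// ltW.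
  lra.
- move=> x Cx; suff Dx : D x = 0 by rewrite /phi Dx mul0r subr0 maxEle ler01.
  apply/le_anti; rewrite D0 andbT; apply: ge_inf => //; exists x => //; exact: distxx.
- move=> x; rewrite /phi lt_max ltxx/= subr_gt0 ltr_pdivrMr// mul1r => Dx.
  have sD : 0 < s - D x by rewrite subr_gt0.
  have [_ [c Cc <-] cx] := inf_adherent sD (Dinf x).
  by exists c => //; move: cx; rewrite -/(D x) addrC subrK.
Qed.

(** * Borel probabilities *)

Lemma measurable_borel_open {R : realType} {X : pmetricType R} (A : set X) :
  open A -> measurable (A : set (borel X)).
Proof. by move=> oA; apply: sub_sigma_algebra. Qed.

Lemma measurable_borel_closed {R : realType} {X : pmetricType R} (A : set X) :
  closed A -> measurable (A : set (borel X)).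
Proof.
by move=> cA; rewrite -[A]setCK; apply: measurableC; apply: measurable_borel_open; rewrite openC.
Qed.

Lemma measurable_borel_preimage {R : realType} {X : pmetricType R} (g : X -> X) (A : set X) :
  continuous g -> measurable (A : set (borel X)) -> measurable (g @^-1` A : set (borel X)).
Proof.
move=> cg mA.
have mg : measurable_fun [set: borel X] (g : borel X -> borel X).
  apply: (@measurability _ _ (borel X) (borel X) setT g (@open X)) => // _ [B oB <-].
  rewrite setTI.
  by apply: measurable_borel_open; apply: open_comp => // x _; exact: cg.
by rewrite -[_ @^-1` _]setTI; exact: mg.
Qed.

Lemma iter_invariant {R : realType} {X : pmetricType R} (g : X -> X) (nu : probability (borel X) R)
  (A : set X) n : continuous g -> f_invariant g nu -> measurable (A : set (borel X)) ->
  nu (iter n g @^-1` A) = nu A.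
Proof.
move=> cg ig; elim: n A => [|n ih] A mA //.
rewrite (_ : iter n.+1 g @^-1` A = iter n g @^-1` (g @^-1` A))//.
by rewrite ih ?ig//; exact: measurable_borel_preimage.
Qed.

Definition prob {R : realType} {X : pmetricType R} (nu : probability (borel X) R) (A : set X) : R :=
  fine (nu (A : set (borel X))).

Lemma probE {R : realType} {X : pmetricType R} (nu : probability (borel X) R) (A : set X) :
  measurable (A : set (borel X)) -> nu A = (prob nu A)%:E.
Proof. by move=> mA; rewrite /prob fineK// fin_num_measure. Qed.

Lemma prob_ge0 {R : realType} {X : pmetricType R} (nu : probability (borel X) R) (A : set X) :
  0 <= prob nu A.
Proof. exact: fine_ge0. Qed.

Lemma prob_le1 {R : realType} {X : pmetricType R} (nu : probability (borel X) R) (A : set X) :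
  measurable (A : set (borel X)) -> prob nu A <= 1.
Proof. by move=> mA; rewrite -lee_fin -probE// probability_le1. Qed.

Lemma prob_mono {R : realType} {X : pmetricType R} (nu : probability (borel X) R) (A B : set X) :
  measurable (A : set (borel X)) -> measurable (B : set (borel X)) -> A `<=` B ->
  prob nu A <= prob nu B.
Proof. by move=> mA mB AB; rewrite -lee_fin -!probE// le_measure// inE. Qed.

Lemma prob_setT {R : realType} {X : pmetricType R} (nu : probability (borel X) R) :
  prob nu setT = 1.
Proof. by rewrite /prob probability_setT. Qed.

Lemma prob_setD {R : realType} {X : pmetricType R} (nu : probability (borel X) R) (A B : set X) :
  measurable (A : set (borel X)) -> measurable (B : set (borel X)) -> B `<=` A ->
  prob nu (A `\` B) = prob nu A - prob nu B.
Proof.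
move=> mA mB BA; apply: EFin_inj; rewrite EFinB -!probE//; last exact: measurableD.
rewrite measureD// ?setIidr// ltey_eq fin_num_measure//.
Qed.

Lemma prob_setU_le {R : realType} {X : pmetricType R} (nu : probability (borel X) R) (A B : set X) :
  measurable (A : set (borel X)) -> measurable (B : set (borel X)) ->
  prob nu (A `|` B) <= prob nu A + prob nu B.
Proof.
move=> mA mB; rewrite -lee_fin EFinD -!probE//; last exact: measurableU.
exact: measureU2.
Qed.

Lemma prob_bigcup_fin {R : realType} {X : pmetricType R} {T : finType}
    (nu : probability (borel X) R) (P : pred T) (A : T -> set X) :
  (forall t, measurable (A t : set (borel X))) ->
  (forall s t x, A s x -> A t x -> s = t) ->
  prob nu [set x | exists2 t, P t & A t x] = \sum_(t | P t) prob nu (A t).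
Proof.
move=> mA dA.
have -> : [set x | exists2 t, P t & A t x] = \bigcup_(t in [set` P]) A t.
  by apply/seteqP; split => x /= [t Pt At]; exists t.
apply: EFin_inj; rewrite -probE; last first.
  by apply: fin_bigcup_measurable => // t _; exact: mA.
rewrite measure_fin_bigcup//; last first.
  by move=> s t _ _ [x [As At]]; exact: dA As At.
rewrite -(@bigfs _ _ _ _ (index_enum T) P)//; last 2 first.
- exact: index_enum_uniq.
- by move=> t _; rewrite mem_index_enum.
by rewrite -sumEFin; apply: eq_bigr => t _; exact: probE.
Qed.

Lemma prob_continuity_below {R : realType} {X : pmetricType R} (nu : probability (borel X) R)
    (F : nat -> set X) (t : R) :
  (forall n, measurable (F n : set (borel X))) -> (forall n m, (n <= m)%N -> F n `<=` F m) ->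
  0 < t -> exists n, prob nu (\bigcup_n F n `\` F n) < t.
Proof.
move=> mF hF t0.
have mU : measurable (\bigcup_n F n : set (borel X)) by exact: bigcupT_measurable.
have : (nu \o F) @ \oo --> nu (\bigcup_n F n).
  by apply: nondecreasing_cvg_mu => // n m nm; apply/subsetPset; exact: hF.
rewrite (probE nu _ mU) => /fine_cvg/cvgrPdist_lt/(_ _ t0)[n _ /(_ n (leqnn n))] /= h.
exists n; rewrite prob_setD//; last by move=> x Fx; exists n.
by apply: le_lt_trans h; exact: ler_norm.
Qed.

(** The sets squeezed between a closed and an open set of nearly equal mass form a sigma-algebra
    containing the open sets. The open side is carried along because complements exchange the two
    roles. *)
Lemma prob_closed_approx {R : realType} {X : pmetricType R} (nu : probability (borel X) R)
  (A : set X) (tau : R) : measurable (A : set (borel X)) -> 0 < tau ->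
  exists K : set X, [/\ closed K, K `<=` A & prob nu (A `\` K) < tau].
Proof.
move=> mA.
pose G : set (set X) := [set A | measurable (A : set (borel X)) /\ forall tau : R, 0 < tau ->
  exists K O : set X, [/\ closed K, open O, K `<=` A, A `<=` O & prob nu (O `\` K) < tau]].
suff : G A.
  case=> _ GA tau0; have [K [V [cK oV KA AV VK]]] := GA _ tau0.
  exists K; split => //; apply: le_lt_trans VK.
  have mK := measurable_borel_closed _ cK.
  apply: prob_mono; [exact: measurableD|apply: measurableD => //; exact: measurable_borel_open|].
  by move=> x [/AV Vx nKx].
move: A mA; apply: smallest_sub.
  split.
  - split; first exact: measurable0.
    move=> t t0; exists set0, set0; split => //; [exact: closed0|exact: open0|].
    by rewrite setDv /prob measure0.
  - move=> A [mA GA]; rewrite setTD; split; first exact: measurableC.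
    move=> t t0; have [K [V [cK oV KA AV VK]]] := GA _ t0.
    exists (~` V), (~` K); split; [by rewrite closedC|by rewrite openC|exact: subsetC|exact: subsetC|].
    by rewrite setDE setCK setIC -setDE.
  - move=> A GA; have mA n : measurable (A n : set (borel X)) by case: (GA n).
    split; first exact: bigcupT_measurable.
    move=> t t0; have t2 : 0 < t / 2 by lra.
    have tn n : 0 < t / 2 / (2 ^ n.+1)%:R :> R by rewrite divr_gt0// ltr0n expn_gt0.
    have [K KP] : {K : nat -> set X * set X & forall n, [/\ closed (K n).1, open (K n).2,
        (K n).1 `<=` A n, A n `<=` (K n).2 & prob nu ((K n).2 `\` (K n).1) < t / 2 / (2 ^ n.+1)%:R]}.
      apply: (@choice _ _ (fun n (K : set X * set X) => [/\ closed K.1, open K.2,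
        K.1 `<=` A n, A n `<=` K.2 & prob nu (K.2 `\` K.1) < t / 2 / (2 ^ n.+1)%:R])) => n.
      by have [_ /(_ _ (tn n))[C [V h]]] := GA n; exists (C, V).
    have mK n : measurable ((K n).1 : set (borel X)).
      by apply: measurable_borel_closed; case: (KP n).
    have mO n : measurable ((K n).2 : set (borel X)).
      by apply: measurable_borel_open; case: (KP n).
    (* The union of all inner closed sets need not be closed; a finite part of it is, and loses less
       than t / 2. The other t / 2 pays for the geometric series of errors. *)
    pose F n := \big[setU/set0]_(i < n.+1) (K i).1.
    have mF n : measurable (F n : set (borel X)).
      by apply: bigsetU_measurable => i _; exact: mK.
    have hF n m : (n <= m)%N -> F n `<=` F m by move=> nm; exact: (@subset_bigsetU _ (fun i => (K i).1) n.+1 m.+1).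
    have FE : \bigcup_n F n = \bigcup_n (K n).1 by exact: (bigcup_bigsetU_bigcup (fun i => (K i).1)).
    have [n nP] := prob_continuity_below nu F (t / 2) mF hF t2.
    have OF : \bigcup_n (K n).2 `\` F n `<=`
        (\bigcup_n F n `\` F n) `|` \bigcup_n ((K n).2 `\` (K n).1).
      move=> x [[i _ Oix] nFx]; have [Kx|nKx] := pselect ((K i).1 x).
        by left; split => //; rewrite FE; exists i.
      by right; exists i.
    have mU : measurable (\bigcup_n ((K n).2 `\` (K n).1) : set (borel X)).
      by apply: bigcupT_measurable => i; exact: measurableD.
    exists (F n), (\bigcup_n (K n).2); split.
    + rewrite /F -(big_mkord xpredT (fun i => (K i).1)).
      by apply: closed_bigsetU => i _; case: (KP i).
    + by apply: bigcup_open => i _; case: (KP i).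
    + apply: (@subset_trans _ (\bigcup_n F n)); first by move=> x Fx; exists n.
      by rewrite FE; apply: subset_bigcup => i _; case: (KP i).
    + by apply: subset_bigcup => i _; case: (KP i).
    + apply: (@le_lt_trans _ _ (prob nu (\bigcup_n F n `\` F n) + prob nu (\bigcup_n ((K n).2 `\` (K n).1)))).
        apply: le_trans (prob_setU_le nu _ _ _ mU); last first.
          by apply: measurableD => //; exact: bigcupT_measurable.
        apply: prob_mono => //; first by apply: measurableD => //; exact: bigcupT_measurable.
        by apply: measurableU => //; apply: measurableD => //; exact: bigcupT_measurable.
      have : prob nu (\bigcup_n ((K n).2 `\` (K n).1)) <= t / 2.
        rewrite -lee_fin -probE//.
        apply: le_trans (epsilon_trick0 xpredT (ltW t2)).
        apply: le_trans (measure_sigma_subadditive nu _ mU (@subset_refl _ _)) _.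
          by move=> i; exact: measurableD.
        apply: lee_nneseries => [i _ _|i _]; first exact: measure_ge0.
        apply: (@le_trans _ _ (prob nu ((K i).2 `\` (K i).1))%:E).
          by rewrite -(probE nu _ (measurableD (mO i) (mK i))).
        by rewrite lee_fin ltW//; case: (KP i).
      move: nP; lra.
move=> O oO; split; first exact: measurable_borel_open.
move=> t t0.
(* The points at distance at least 1 / (n + 1) from the complement of O: closed sets increasing to
   O. *)
pose K n : set X := [set x | forall y, dist x y < (n.+1%:R^-1 : R) -> O y].
have cK n : closed (K n).
  apply/closed_dist => x hx y xy.
  have h0 : 0 < (n.+1%:R^-1 : R) - dist x y by rewrite subr_gt0.
  have [z Kz xz] := hx _ h0.
  apply: Kz; have := dist_triangle x z y; rewrite (dist_sym z x); move: xz.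
  by move: (n.+1%:R^-1 : R) => a; lra.
have mK n : measurable (K n : set (borel X)) by apply: measurable_borel_closed; exact: cK.
have KO : \bigcup_n K n = O.
  apply/seteqP; split => [x [n _]|x Ox]; first by apply; rewrite distxx.
  move/open_dist : oO => /(_ x Ox)[r r0 rO]; have [n nP] := invr_nat_lt _ r0.
  by exists n => // y xy; apply: rO; apply: lt_trans xy (nP _ _).
have [|n nP] := prob_continuity_below nu K t mK _ t0.
  move=> n m nm x Kx y xy; apply: Kx; apply: lt_le_trans xy _.
  by rewrite lef_pV2 ?posrE// ler_nat.
exists (K n), O; split => //; first by rewrite -KO => x Kx; exists n.
by rewrite -KO.
Qed.

(** Each point off the support has a null neighbourhood. These are reduced to countably many null
    balls, centred in finite nets and of radii 1 / (n + 1). *)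
Lemma msupport_prob0 {R : realType} {X : pmetricType R} (nu : probability (borel X) R) :
  compact [set: X] -> closed (msupport nu) /\ prob nu (~` msupport nu) = 0.
Proof.
move=> cX.
have cS : closed (msupport nu).
  apply/closed_dist => x hx V oV Vx; move/open_dist : (oV) => /(_ x Vx)[r r0 rV].
  by have [y Sy xy] := hx _ r0; apply: Sy => //; exact: rV.
split => //.
have [s sP] : {s : nat -> seq X & forall n x, exists2 c, c \in s n & dist c x < (n.+1%:R^-1 : R)}.
  apply: (@choice _ _ (fun n (s : seq X) => forall x, exists2 c, c \in s &
    dist c x < (n.+1%:R^-1 : R))) => n.
  by apply: compact_finite_net; rewrite ?invr_gt0.
suff : nu.-negligible (~` msupport nu : set (borel X)).
  have mS : measurable (~` msupport nu : set (borel X)).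
    by apply: measurable_borel_open; rewrite openC.
  by move/negligibleP => /(_ mS) h; rewrite /prob h.
pose N n : set (borel X) := \big[setU/set0]_(c <- s n | nu (ball c (n.+1%:R^-1 : R)) == 0%E) ball c (n.+1%:R^-1 : R).
have oB (c : X) (r : R) : open (ball c r).
  rewrite ball_distE; apply/open_dist => y /= xy; exists (r - dist c y); first by rewrite subr_gt0.
  by move=> z yz; have := dist_triangle y c z; lra.
apply: (@negligibleS _ _ _ nu (\bigcup_n N n)).
  move=> x nSx; have [V [oV Vx nuV]] : exists V : set X, [/\ open V, V x & nu V = 0%E].
    apply: contrapT => h; apply: nSx => V oV Vx; rewrite lt_neqAle measure_ge0 andbT.
    by apply/negP => /eqP nuV; apply: h; exists V.
  move/open_dist : (oV) => /(_ x Vx)[r r0 rV].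
  have r2 : 0 < r / 2 by lra.
  have [n /(_ n (leqnn n)) nr] := invr_nat_lt _ r2.
  have [c cs cx] := sP n x; exists n => //; rewrite /N -bigcup_seq_cond.
  exists c => /=; last by rewrite ball_distE.
  rewrite cs/=; apply/eqP/le_anti; rewrite measure_ge0 andbT -nuV.
  apply: le_measure; rewrite ?inE; [exact: measurable_borel_open|exact: measurable_borel_open|].
  move=> y; rewrite ball_distE/= => cy; apply: rV; have := dist_triangle c x y.
  by rewrite (dist_sym x c); move: cx cy nr; generalize (n.+1%:R^-1 : R) => a; lra.
apply: negligible_bigcup => n; rewrite /N; elim/big_ind : _ => //.
- exact: negligible_set0.
- by move=> A B nA nB; exact: negligibleU.
- by move=> c /eqP nc; apply/negligibleP => //; exact: measurable_borel_open.
Qed.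

(** * Finite labels and their words *)

(** A finite measurable partition is encoded as a map to a finite type, with the fibres as cells.
    Joins become maps to products or words, and coarsening becomes composition. *)
Definition mlabel {R : realType} {X : pmetricType R} {T : finType} (F : X -> T) : Prop :=
  forall t, measurable (F @^-1` [set t] : set (borel X)).

Definition cellp {R : realType} {X : pmetricType R} {T : finType}
  (nu : probability (borel X) R) (F : X -> T) (t : T) : R := prob nu (F @^-1` [set t]).

Definition ent {R : realType} {X : pmetricType R} {T : finType}
  (nu : probability (borel X) R) (F : X -> T) : R := \sum_t entropy_fun (cellp nu F t).

Definition name {R : realType} {X : pmetricType R} {T : finType}
  (a : X -> T) (g : X -> X) n (x : X) : {ffun 'I_n -> T} := [ffun i : 'I_n => a (iter i g x)].

Lemma mlabel_preimage {R : realType} {X : pmetricType R} {T : finType} (F : X -> T) (P : pred T) :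
  mlabel F -> measurable ([set x | P (F x)] : set (borel X)).
Proof.
move=> mF; rewrite (_ : [set x | P (F x)] = \bigcup_(t in [set` P]) (F @^-1` [set t])).
  by apply: fin_bigcup_measurable => // t _; exact: mF.
by apply/seteqP; split => [x /= Px|x [t /= Pt Ft]]; [exists (F x)|rewrite Ft].
Qed.

Lemma prob_preimage {R : realType} {X : pmetricType R} {T : finType}
    (nu : probability (borel X) R) (F : X -> T) (P : pred T) :
  mlabel F -> prob nu [set x | P (F x)] = \sum_(t | P t) cellp nu F t.
Proof.
move=> mF; rewrite -prob_bigcup_fin//; last by move=> s t x /= <- <-.
congr (prob nu _); apply/seteqP; split => [x /= Px|x /= [t Pt Ft]]; first by exists (F x).
by rewrite Ft.
Qed.

Lemma cellp_comp {R : realType} {X : pmetricType R} {T P : finType}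
    (nu : probability (borel X) R) (F : X -> T) (phi : T -> P) p :
  mlabel F -> cellp nu (phi \o F) p = \sum_(t | phi t == p) cellp nu F t.
Proof.
move=> mF; rewrite -prob_preimage// /cellp; congr (prob nu _).
by apply/seteqP; split => x /= /eqP.
Qed.

Lemma cellp_ge0 {R : realType} {X : pmetricType R} {T : finType}
    (nu : probability (borel X) R) (F : X -> T) t : 0 <= cellp nu F t.
Proof. exact: prob_ge0. Qed.

Lemma cellp_sum1 {R : realType} {X : pmetricType R} {T : finType}
    (nu : probability (borel X) R) (F : X -> T) : mlabel F -> \sum_t cellp nu F t = 1.
Proof.
move=> mF; rewrite -(prob_preimage nu F xpredT)// -(prob_setT nu).
by congr (prob nu _); apply/seteqP; split.
Qed.

Lemma ent_ge0 {R : realType} {X : pmetricType R} {T : finType}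
    (nu : probability (borel X) R) (F : X -> T) : mlabel F -> 0 <= ent nu F.
Proof.
move=> mF; apply: sumr_ge0 => t _; apply: entropy_fun_ge0; first exact: prob_ge0.
by apply: prob_le1; exact: mF.
Qed.

Lemma ent_gibbs {R : realType} {X : pmetricType R} {T P Q : finType}
    (nu : probability (borel X) R) (F : X -> T) (phi : T -> P) (psi : T -> Q) (w : T -> R) :
  mlabel F -> (forall t, 0 <= w t) -> (forall t, 0 < cellp nu F t -> 0 < w t) ->
  (forall q, \sum_(t | psi t == q) w t <= 1) ->
  ent nu (phi \o F) <= ent nu (psi \o F) + \sum_t cellp nu F t * - ln (w t).
Proof.
move=> mF w0 wpos w1.
have := gibbs _ _ phi psi (cellp_ge0 nu F) w0 wpos w1.
rewrite /ent; under eq_bigr do rewrite -cellp_comp//.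
by under [X in _ <= X + _ -> _]eq_bigr do rewrite -cellp_comp//.
Qed.

Lemma mlabel_iter {R : realType} {X : pmetricType R} {T : finType} (a : X -> T) (g : X -> X) i :
  continuous g -> mlabel a -> mlabel (a \o iter i g).
Proof.
move=> cg ma t.
exact: (measurable_borel_preimage (iter i g) _ (continuous_iter _ i cg) (ma t)).
Qed.

Lemma mlabel_ffun {R : realType} {X : pmetricType R} {T : finType} n (b : 'I_n -> X -> T) :
  (forall i, mlabel (b i)) -> mlabel (fun x => [ffun i => b i x]).
Proof.
move=> mb k; rewrite (_ : _ @^-1` _ = \bigcap_(i in [set: 'I_n]) (b i @^-1` [set k i])).
  by apply: fin_bigcap_measurable => // i _; exact: mb.
apply/seteqP; split => [x /= <- i _ /=|x h /=]; first by rewrite ffunE.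
by apply/ffunP => i; rewrite ffunE; exact: h.
Qed.

Lemma mlabel_name {R : realType} {X : pmetricType R} {T : finType} (a : X -> T) (g : X -> X) n :
  continuous g -> mlabel a -> mlabel (name a g n).
Proof. by move=> cg ma; apply: mlabel_ffun => i; exact: mlabel_iter. Qed.

Lemma mlabel_pair {R : realType} {X : pmetricType R} {S T : finType} (a : X -> S) (b : X -> T) :
  mlabel a -> mlabel b -> mlabel (fun x => (a x, b x)).
Proof.
move=> ma mb [s t]; rewrite (_ : _ @^-1` _ = a @^-1` [set s] `&` b @^-1` [set t]).
  exact: measurableI.
by apply/seteqP; split => x /= [-> ->].
Qed.

Lemma cellp_iter {R : realType} {X : pmetricType R} {T : finType} (nu : probability (borel X) R)
    (a : X -> T) (g : X -> X) i t : continuous g -> f_invariant g nu -> mlabel a ->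
  cellp nu (a \o iter i g) t = cellp nu a t.
Proof.
move=> cg ig ma; rewrite /cellp /prob; congr fine.
exact: (iter_invariant g nu (a @^-1` [set t]) i cg ig (ma t)).
Qed.

(** [ent_gibbs] for the pair of the first m and the next n letters: the second word is guessed by
    its own law, regardless of the first. By invariance this law is that of the first n letters, and
    the mean of - ln w is their entropy. *)
Lemma ent_name_subadditive {R : realType} {X : pmetricType R} {T : finType}
    (nu : probability (borel X) R) (a : X -> T) (g : X -> X) m n :
  continuous g -> f_invariant g nu -> mlabel a ->
  ent nu (name a g (m + n)) <= ent nu (name a g m) + ent nu (name a g n).
Proof.
move=> cg ig ma.
pose F x := (name a g m x, (name a g n \o iter m g) x).
have mN k := mlabel_name a g k cg ma.
have mF : mlabel F by apply: mlabel_pair => //; exact: mlabel_iter.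
pose cat (p : {ffun 'I_m -> T} * {ffun 'I_n -> T}) : {ffun 'I_(m + n) -> T} :=
  [ffun i => match fintype.split i with inl j => p.1 j | inr j => p.2 j end].
have catE : name a g (m + n) = cat \o F.
  apply/funext => x; apply/ffunP => i; rewrite /cat /= !ffunE.
  case: fintype.splitP => j ij; rewrite ffunE ij//.
  by rewrite addnC iterD.
have snd_cellp t : cellp nu (snd \o F) t = cellp nu (name a g n) t.
  by rewrite -(cellp_iter nu _ g m t cg ig (mN n)).
rewrite catE; apply: le_trans (ent_gibbs nu F cat fst (fun t => cellp nu (name a g n) t.2) mF _ _ _) _.
- by move=> t; exact: cellp_ge0.
- move=> t /lt_le_trans; apply; rewrite -snd_cellp cellp_comp//.
  by rewrite (bigD1 t)//= lerDl sumr_ge0// => *; exact: cellp_ge0.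
- move=> q; rewrite -(cellp_sum1 nu _ (mN n)).
  rewrite (reindex_onto (fun s => (q, s)) snd) /=; last by move=> [? ?] /= /eqP ->.
  by rewrite (eq_bigl xpredT)// => s; rewrite !eqxx.
rewrite (_ : fst \o F = name a g m)// lerD2l /ent le_eqVlt; apply/orP; left; apply/eqP.
rewrite (partition_big snd xpredT)//=; apply: eq_bigr => s _.
rewrite /entropy_fun -mulrN -{1}snd_cellp cellp_comp// mulr_suml.
by apply: eq_bigr => t /eqP <-.
Qed.

Lemma ent_name_limit {R : realType} {X : pmetricType R} {T : finType}
    (nu : probability (borel X) R) (a : X -> T) (g : X -> X) :
  continuous g -> f_invariant g nu -> mlabel a ->
  cvgn (fun n => n%:R^-1 * ent nu (name a g n)) /\
  forall n, (0 < n)%N ->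
    limn (fun n => n%:R^-1 * ent nu (name a g n)) <= n%:R^-1 * ent nu (name a g n).
Proof.
move=> cg ig ma; apply: (fekete (fun n => ent nu (name a g n))).
  by move=> n; apply: ent_ge0; exact: mlabel_name.
by move=> m n; exact: ent_name_subadditive.
Qed.

(** Disjointness makes the fibres of the chosen index exactly the pieces, so the entropies defined
    through lists of sets can be handled through labels. *)
Lemma finite_partition_label {R : realType} {X : pmetricType R} (xi : seq (set X)) :
  finite_partition xi -> exists a : X -> 'I_(size xi),
    [/\ mlabel a, forall x, nth set0 xi (a x) x &
        forall (nu : probability (borel X) R) g n,
          join_entropy nu g xi n = ent nu (name a g n)].
Proof.
move=> [mxi dxi cxi].
have [a aP] : {a : X -> 'I_(size xi) & forall x, nth set0 xi (a x) x}.
  apply: (@choice _ _ (fun x (i : 'I_(size xi)) => nth set0 xi i x)) => x.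
  have : [set: X] x by [].
  by rewrite -cxi => -[i /= ix xix]; exists (Ordinal ix).
have aE i : a @^-1` [set i] = nth set0 xi i.
  apply/seteqP; split => [x /= <-//|x xix /=].
  apply/val_inj/eqP; apply/negPn/negP => /eqP ne.
  have := dxi _ _ (ltn_ord (a x)) (ltn_ord i) ne; rewrite -subset0; by apply.
exists a; split => //; first by move=> i; rewrite aE; exact: mxi.
move=> nu g n; rewrite /join_entropy /ent; apply: eq_bigr => k _.
congr (entropy_fun (fine (nu _))); apply/seteqP; split => [x h|x /= <- i _ /=].
  apply/ffunP => i; rewrite ffunE; have := h i I; rewrite -aE; exact.
by rewrite ffunE.
Qed.

(** * Covers by sets that stay close *)

Definition nclose {R : realType} {X : pmetricType R} (g : X -> X) (d : R) (n : nat) (C : set X) :=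
  forall z z' i, C z -> C z' -> (i < n)%N -> dist (iter i g z) (iter i g z') <= d.

(** Pieces of small diameter in the n-th Bowen metric, rather than balls with centres, pass to
    subsets without loss. The bound [M] is real, so exponential rates can be used directly. *)
Definition ncover {R : realType} {X : pmetricType R} (g : X -> X) (d : R) (A : set X) (n : nat) (M : R) :=
  exists (J : finType) (C : J -> set X),
    [/\ #|J|%:R <= M, forall z, A z -> exists j, C j z & forall j, nclose g d n (C j)].

Lemma ncover_sub {R : realType} {X : pmetricType R} (g : X -> X) (d : R) (A B : set X) n (M N : R) :
  A `<=` B -> M <= N -> ncover g d B n M -> ncover g d A n N.
Proof.
move=> AB MN [J [C [JM CB hC]]]; exists J, C; split => //; first exact: le_trans JM MN.
by move=> z /AB; exact: CB.
Qed.

(** Pieces for the first n iterates are intersected with the pullbacks of the pieces for the next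
    m. *)
Lemma ncover_cat {R : realType} {X : pmetricType R} (g : X -> X) (d : R) (A : set X) n m (M N : R) :
  ncover g d A n M -> ncover g d (iter n g @` A) m N -> ncover g d A (n + m) (M * N).
Proof.
move=> [J [C [JM CA hC]]] [K [D [KN DA hD]]].
exists (J * K)%type, (fun p => C p.1 `&` iter n g @^-1` D p.2); split.
- by rewrite card_prod natrM ler_pM.
- move=> z Az; have [j Cj] := CA z Az; have [|k Dk] := DA (iter n g z); first by exists z.
  by exists (j, k).
- move=> [j k] z z' i /= [Cz Dz] [Cz' Dz'] im; have [lt|ge] := ltnP i n.
    exact: (hC j).
  by rewrite -(subnK ge) !iterD; apply: (hD k) => //; rewrite ltn_subLR.
Qed.

(** A crude exponential bound from a finite net, to be spent only on time intervals of bounded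
    length. *)
Lemma ncover_setT {R : realType} {X : pmetricType R} (g : X -> X) (d : R) :
  compact [set: X] -> 0 < d -> exists2 c : R, 1 <= c & forall n, ncover g d setT n (c ^+ n).
Proof.
move=> cX d0; have d2 : 0 < d / 2 by lra.
have [s sP] := compact_finite_net _ cX d2.
have c1 : ncover g d setT 1 ((size s)%:R + 1).
  exists 'I_(size s), (fun j : 'I_(size s) => [set z | dist (nth point s j) z < d / 2]); split.
  - by rewrite card_ord lerDl.
  - move=> z _; have [c cs cz] := sP z; have ci : (index c s < size s)%N by rewrite index_mem.
    by exists (Ordinal ci); rewrite /= nth_index.
  - move=> j z z' [|//] /= jz jz' _; have := dist_triangle (nth point s j) z z'.
    rewrite (dist_sym z (nth point s j)); lra.
exists ((size s)%:R + 1); first by rewrite lerDr.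
move=> n; elim: n => [|n ih].
  exists unit, (fun=> setT); split => //; first by rewrite card_unit expr0.
rewrite -add1n exprD expr1; apply: ncover_cat => //.
by apply: ncover_sub ih.
Qed.

(** * Spanning sets and zero topological entropy *)

Lemma spans_exists {R : realType} {X : pmetricType R} (g : X -> X) (K : set X) n (d : R) :
  compact [set: X] -> 0 < d -> exists E, spans g K n d E.
Proof.
move=> cX d0; have [c _ /(_ n)[J [C [_ CT hC]]]] := ncover_setT g _ cX d0.
exists [seq get (C j) | j <- enum J] => y _; have [j Cj] := CT y I.
exists (get (C j)); first by apply: map_f; rewrite mem_enum.
by move=> i /(hC j); apply => //; exact: getI Cj.
Qed.

(** A nonempty set of natural numbers has a least element; in particular [rspan] is finite, and
    [fine] in [htop_set] loses nothing. *)
Lemma rspan_attained {R : realType} {X : pmetricType R} (g : X -> X) (K : set X) n (d : R) :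
  compact [set: X] -> 0 < d ->
  exists2 E, spans g K n d E & rspan g K n d = ((size (undup E))%:R)%:E.
Proof.
move=> cX d0; pose P k := `[< exists2 E, spans g K n d E & size (undup E) = k >].
have exP : exists k, P k.
  by have [E sE] := spans_exists g K n _ cX d0; exists (size (undup E)); apply/asboolP; exists E.
case: (ex_minnP exP) => k /asboolP[E sE Ek] kmin; exists E => //.
apply/le_anti/andP; split; first by apply: ereal_inf_lbound; exists E.
apply: le_ereal_inf_tmp => _ [E' sE' <-]; rewrite lee_fin ler_nat Ek; apply: kmin.
by apply/asboolP; exists E'.
Qed.

(** The case m = 0 holds by the convention [ln 0 = 0]; it occurs because the empty set is spanned by
    the empty sequence. *)
Lemma ln_nat_mono {R : realType} m n : (m <= n)%N -> ln (m%:R : R) <= ln (n%:R : R).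
Proof.
case: m => [|m] mn; last by rewrite ler_ln ?posrE ?ltr0n ?ler_nat//; exact: leq_trans mn.
rewrite ln0//; case: n mn => [|n] _; first by rewrite ln0.
by apply: ln_ge0; rewrite ler1n.
Qed.

Lemma limn_esup_mono {R : realType} (u v : nat -> \bar R) :
  (forall n, (u n <= v n)%E) -> (limn_esup u <= limn_esup v)%E.
Proof.
move=> uv; apply: le_ereal_inf_tmp => _ [V FV <-].
apply: (@le_trans _ _ (ereal_sup (u @` V))); first by apply: ereal_inf_lbound; exists V.
apply: ge_ereal_sup => _ [n Vn <-]; apply: le_trans (uv n) _.
by apply: ereal_sup_ubound; exists n.
Qed.

(** The growth rate at scale d increases as d decreases, so the limit at 0 is a supremum. If it is
    0, the upper limit at each scale is below b, which yields one good time m. *)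
Lemma htop0_span {R : realType} {X : pmetricType R} (g : X -> X) (K : set X) (d b : R) :
  compact [set: X] -> htop_set K g = 0%E -> 0 < d -> 0 < b ->
  exists (m : nat) (E : seq X), [/\ (0 < m)%N, spans g K m d E & (size E)%:R <= expR (b * m%:R)].
Proof.
move=> cX h0 d0 b0.
pose u (d : R) (n : nat) : \bar R := ((n%:R)^-1 * ln (fine (rspan g K n d)))%:E.
pose F (d : R) := limn_esup (u d).
have Fmono : {in Interval (BRight 0) (BInfty R false) &,
    {homo F : x y / (x <= y)%R >-> (y <= x)%E}}.
  move=> x y; rewrite !in_itv/= !andbT => x0 y0 xy; apply: limn_esup_mono => n.
  rewrite lee_fin ler_wpM2l ?invr_ge0//.
  have [E sE ->] := rspan_attained g K n _ cX x0.
  have [E' sE' E'E] := rspan_attained g K n _ cX y0; rewrite E'E/=.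
  apply: ln_nat_mono; rewrite -(ler_nat R) -lee_fin -E'E; apply: ereal_inf_lbound.
  exists E => // z /sE[e eE h]; exists e => // j /h /le_trans; exact.
have := nonincreasing_at_right_cvge _ _ Fmono => /(_ isT) /cvg_lim.
have -> : lim (F x @[x --> 0^'+]) = 0%E by exact: h0.
move=> /(_ (@ereal_hausdorff R)) /esym supF.
have Fd : (F d <= 0)%E.
  rewrite -supF; apply: ereal_sup_ubound; exists d => //=.
  by rewrite in_itv/= d0.
have : (F d < b%:E)%E by apply: le_lt_trans Fd _; rewrite lte_fin.
move=> /ereal_inf_lt[_ [V [N _ NV] <-] supV].
(* The successor makes the chosen time positive. *)
have VN : V N.+1 by apply: NV => /=.
have : (u d N.+1 <= b%:E)%E.
  by apply: ltW; apply: le_lt_trans supV; apply: ereal_sup_ubound; exists N.+1.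
have [E sE rE] := rspan_attained g K N.+1 _ cX d0.
rewrite /u rE/= lee_fin mulrC ler_pdivrMr ?ltr0n// => h.
exists N.+1, (undup E); split => //.
  by move=> y /sE[e eE he]; exists e => //; rewrite mem_undup.
move: h; case: (size (undup E)) => [|k] h; first exact: expR_ge0.
by rewrite -ler_ln ?posrE ?ltr0n ?expR_gt0// expRK.
Qed.

(** * From zero entropy of the sets [Gamma] to covers of Bowen balls *)

Lemma iter_equicontinuous {R : realType} {X : pmetricType R} (g : X -> X) (z : X) m (e : R) :
  continuous g -> 0 < e ->
  exists2 d : R, 0 < d & forall z' j, dist z z' < d -> (j < m)%N ->
    dist (iter j g z) (iter j g z') < e.
Proof.
move=> cg e0; elim: m => [|m [d d0 dP]]; first by exists 1.
have /continuous_dist/(_ z e e0)[d' d'0 d'P] := continuous_iter g m cg.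
exists (Num.min d d'); first by rewrite lt_min d0.
move=> z' j; rewrite lt_min => /andP[zd zd']; rewrite ltnS leq_eqVlt => /predU1P[->|jm].
  exact: d'P.
exact: dP.
Qed.

(** With [h] the inverse of [g], a finite-time approximation of [Gamma e u g], which is the
    intersection over all [N]. *)
Definition two_sided_ball {R : realType} {X : pmetricType R} (g h : X -> X) (e : R) N (u : X) : set X :=
  [set z | forall i, (i <= N)%N ->
    dist (iter i g z) (iter i g u) <= e /\ dist (iter i h z) (iter i h u) <= e].

(** The points z only accumulate at w, while u converges to y; a late index chosen for z therefore
    serves both. *)
Lemma limit_pair_le {R : realType} {X : pmetricType R} (g : X -> X) (u z : nat -> X) (y w : X)
    (e : R) N : continuous g ->
  (forall n, dist (u n) y < (n.+1%:R^-1 : R)) ->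
  (forall (r : R) n, 0 < r -> exists2 m, (n <= m)%N & dist (z m) w < r) ->
  (forall m, (N <= m)%N -> dist (g (z m)) (g (u m)) <= e) -> dist (g w) (g y) <= e.
Proof.
move=> /continuous_dist cg uy zw zu; apply/ler_addgt0Pr => t t0.
have t2 : 0 < t / 2 by lra.
have [d1 d10 d1P] := cg y _ t2; have [d2 d20 d2P] := cg w _ t2.
have [M MP] := invr_nat_lt _ d10.
have [m mM zm] := zw _ (maxn M N) d20.
move: mM; rewrite geq_max => /andP[/MP Mm Nm].
have := zu m Nm; have := d2P (z m); rewrite dist_sym => /(_ zm).
have := d1P (u m); rewrite dist_sym => /(_ (lt_trans (uy m) Mm)).
have := dist_triangle (g (z m)) (g w) (g y); have := dist_triangle (g (u m)) (g (z m)) (g y).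
rewrite (dist_sym (g y)); lra.
Qed.

(** If it fails, there are points z_n outside a neighbourhood [V] of [Gamma e y g], in two-sided
    balls of order n about centres tending to y. An accumulation point of the z_n lies in
    [Gamma e y g], which forces some z_n into [V]. *)
Lemma local_cover {R : realType} {X : pmetricType R} (g h : X -> X) (y : X) (e d b : R) :
  compact [set: X] -> continuous g -> continuous h -> cancel g h -> cancel h g ->
  htop_set (Gamma e y g) g = 0%E -> 0 < d -> 0 < b ->
  exists (m N : nat) (r : R), [/\ (0 < m)%N, 0 < r & forall u, dist u y < r ->
    ncover g d (two_sided_ball g h e N u) m (expR (b * m%:R))].
Proof.
move=> cX cg ch gh hg h0 d0 b0.
have d4 : 0 < d / 4 by lra.
have [m [E [m0 sE cE]]] := htop0_span g _ _ _ cX h0 d4 b0.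
exists m; apply: contrapT => hN.
(* [E] spans [Gamma e y g] within d / 4, so d / 4 is left for the approximation; points of [V]
   sharing a centre stay within d of each other. *)
pose V : set X := [set z | exists2 x, x \in E &
  forall j, (j < m)%N -> dist (iter j g z) (iter j g x) < d / 2].
have coverV A : A `<=` V -> ncover g d A m (expR (b * m%:R)).
  move=> AV; exists 'I_(size E), (fun k : 'I_(size E) => [set z | forall j, (j < m)%N ->
    dist (iter j g z) (iter j g (nth point E k)) < d / 2]); split.
  - by rewrite card_ord.
  - move=> z /AV[x xE xP]; have xi : (index x E < size E)%N by rewrite index_mem.
    by exists (Ordinal xi) => /= j jm; rewrite nth_index//; exact: xP.
  - move=> k z z' i /= zP z'P im; have := zP i im; have := z'P i im.
    set c := iter i g (nth point E k); rewrite (dist_sym _ c).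
    have := dist_triangle c (iter i g z) (iter i g z'); lra.
have [u uP] : {u : nat -> X * X & forall n, [/\ dist (u n).1 y < (n.+1%:R^-1 : R),
    two_sided_ball g h e n (u n).1 (u n).2 & ~ V (u n).2]}.
  apply: (@choice _ _ (fun n (p : X * X) => [/\ dist p.1 y < (n.+1%:R^-1 : R),
    two_sided_ball g h e n p.1 p.2 & ~ V p.2])) => n.
  apply: contrapT => hn; apply: hN; exists n, (n.+1%:R^-1 : R).
  split => // v vy; apply: coverV => z Wz; apply: contrapT => nVz; apply: hn.
  by exists (v, z).
have [w wP] := compact_accumulation (fun n => (u n).2) cX.
have uy n : dist (u n).1 y < (n.+1%:R^-1 : R) by case: (uP n).
have Gw : Gamma e y g w.
  split => [n|n v v' vw v'y].
    apply: (limit_pair_le (iter n g) (fun n => (u n).1) (fun n => (u n).2) _ _ _ n) => //.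
      exact: continuous_iter.
    by move=> k nk; have [_ /(_ n nk)[]] := uP k.
  have iterK k x : iter k h (iter k g x) = x.
    by elim: k x => // k ih x; rewrite iterSr /= gh ih.
  rewrite -[v](iterK n) -[v'](iterK n) vw v'y.
  apply: (limit_pair_le (iter n h) (fun n => (u n).1) (fun n => (u n).2) _ _ _ n) => //.
    exact: continuous_iter.
  by move=> k nk; have [_ /(_ n nk)[]] := uP k.
have [x xE xw] := sE w Gw.
have [r r0 rP] := iter_equicontinuous g w m _ cg d4.
have [k _ kw] := wP _ 0%N r0; have [_ _] := uP k; apply; exists x => // j jm.
have := rP (u k).2 j; rewrite dist_sym => /(_ kw jm); have := xw j jm.
have := dist_triangle (iter j g w) (iter j g (u k).2) (iter j g x).
rewrite (dist_sym (iter j g (u k).2) (iter j g w)); lra.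
Qed.

(** Compactness again. One [B] can serve both as bound for m and as order of the ball, since raising
    the order shrinks the ball. *)
Lemma uniform_cover {R : realType} {X : pmetricType R} (g h : X -> X) (S : set X) (e d b : R) :
  compact [set: X] -> continuous g -> continuous h -> cancel g h -> cancel h g -> closed S ->
  (forall y, S y -> htop_set (Gamma e y g) g = 0%E) -> 0 < d -> 0 < b ->
  exists B, forall x, S x -> exists m, [/\ (0 < m)%N, (m <= B)%N &
    ncover g d (two_sided_ball g h e B x) m (expR (b * m%:R))].
Proof.
move=> cX cg ch gh hg cS h0 d0 b0; apply: contrapT => hB.
have [u uP] : {u : nat -> X & forall B, S (u B) /\ ~ exists m, [/\ (0 < m)%N, (m <= B)%N &
    ncover g d (two_sided_ball g h e B (u B)) m (expR (b * m%:R))]}.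
  apply: (@choice _ _ (fun B u => S u /\ ~ exists m, [/\ (0 < m)%N, (m <= B)%N &
    ncover g d (two_sided_ball g h e B u) m (expR (b * m%:R))])) => B.
  apply: contrapT => hn; apply: hB; exists B => x Sx; apply: contrapT => nx.
  by apply: hn; exists x.
have [y yP] := compact_accumulation u cX.
have Sy : S y.
  move/closed_dist : cS; apply => r r0; have [k _ ky] := yP _ 0%N r0.
  by exists (u k); [case: (uP k)|rewrite dist_sym].
have [m [N [r [m0 r0 mP]]]] := local_cover _ _ _ _ _ _ cX cg ch gh hg (h0 y Sy) d0 b0.
have [B] := yP _ (maxn m N) r0; rewrite geq_max => /andP[mB NB] /mP cov.
have [_] := uP B; apply; exists m; split => //; apply: ncover_sub cov => // z Wz i iN.
by apply: Wz; exact: leq_trans NB.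
Qed.

(** Bowen's argument: away from both ends of the time interval, the image of the Bowen ball lies in
    a two-sided ball of order [B] about a point of [S], so the next block of at most [B] iterates is
    covered at rate b. Blocks are concatenated. *)
Lemma bowen_ball_cover {R : realType} {X : pmetricType R} (g h : X -> X) (S : set X) (e d b : R) :
  compact [set: X] -> continuous g -> continuous h -> cancel g h -> cancel h g -> closed S ->
  (forall x, S x -> S (g x)) ->
  (forall y, S y -> htop_set (Gamma e y g) g = 0%E) -> 0 < d -> 0 < b ->
  exists2 c : R, 0 < c & forall n x, S x ->
    ncover g d [set z | forall i, (i < n)%N -> dist (iter i g z) (iter i g x) <= e] n
      (c * expR (b * n%:R)).
Proof.
move=> cX cg ch gh hg cS gS h0 d0 b0.
have [B BP] := uniform_cover _ _ _ _ _ _ cX cg ch gh hg cS h0 d0 b0.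
have [c c1 cP] := ncover_setT g _ cX d0.
have c0 : 0 < c by lra.
have gSn n x : S x -> S (iter n g x) by move=> Sx; elim: n => //= n; exact: gS.
have e1 n : 1 <= expR (b * n%:R) by rewrite -expR0 ler_expR mulr_ge0// ltW.
(* The first [B] iterates and the last ones, at most [B + B], are covered crudely. *)
exists (c ^+ B * c ^+ (B + B)); first by rewrite mulr_gt0 ?exprn_gt0.
move=> n x Sx; set A := [set z | _].
have step k t : (B <= t)%N -> (t + k = n)%N ->
    ncover g d (iter t g @` A) k (c ^+ (B + B) * expR (b * k%:R)).
  elim/ltn_ind: k t => k ih t Bt tk; have [kB|kB] := leqP k (B + B).
    apply: ncover_sub (cP k) => //; apply: (@le_trans _ _ (c ^+ (B + B))).
      by rewrite ler_weXn2l.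
    by rewrite ler_peMr// exprn_ge0// ltW.
  (* Here [B] steps backwards from time t remain nonnegative and [B] steps forwards remain below n,
     so the two-sided condition at time t holds. *)
  have [m [m0 mB mcov]] := BP _ (gSn t x Sx).
  have km : (m <= k)%N by rewrite (leq_trans mB)// ltnW// (leq_ltn_trans _ kB)// leq_addr.
  rewrite -(subnKC km) natrD mulrDr expRD mulrCA; apply: ncover_cat.
    apply: ncover_sub mcov => // _ [z Az <-] i iB; split.
      rewrite -!iterD; apply: Az; rewrite addnC -tk ltn_add2l.
      by rewrite (leq_ltn_trans iB)// (leq_ltn_trans _ kB)// leq_addr.
    have it : (i <= t)%N by exact: leq_trans Bt.
    have hgK k' v : iter k' h (iter k' g v) = v.
      by elim: k' v => // k' ih' v; rewrite iterSr /= gh ih'.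
    rewrite -(subnKC it) !iterD !hgK; apply: Az.
    by rewrite (leq_ltn_trans (leq_subr _ _))// -tk -[X in (X < _)%N]addn0 ltn_add2l (leq_ltn_trans _ kB).
  apply: (ncover_sub _ _ _ (iter (t + m) g @` A)); [|exact: lexx|].
    by move=> _ [_ [z Az <-] <-]; exists z => //; rewrite addnC iterD.
  apply: ih.
  - by rewrite ltn_subrL m0 (leq_trans m0).
  - exact: leq_trans Bt (leq_addr _ _).
  - by rewrite -addnA subnKC.
have [nB|Bn] := ltnP n B.
  apply: ncover_sub (cP n) => //.
  apply: (@le_trans _ _ (c ^+ B)); first by rewrite ler_weXn2l// ltnW.
  have cB : 1 <= c ^+ (B + B) * expR (b * n%:R) by apply: mulr_ege1 => //; exact: exprn_ege1.
  have cB0 : 0 <= c ^+ B by rewrite exprn_ge0// ltW.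
  by rewrite -mulrA ler_peMr.
rewrite -[in X in ncover _ _ _ X _](subnKC Bn) -mulrA.
have := step (n - B)%N B (leqnn B) (subnKC Bn).
move=> covB; apply: ncover_cat; first by apply: ncover_sub (cP B).
apply: ncover_sub covB => //; rewrite ler_pM2l ?exprn_gt0// ler_expR ler_pM2l// ler_nat.
exact: leq_subr.
Qed.

(** * Comparison of partition entropies *)

Lemma finite_uniform {R : realType} {T : finType} (P : T -> R -> Prop) :
  (forall t (s s' : R), s' <= s -> P t s -> P t s') ->
  (forall t, exists2 s : R, 0 < s & P t s) -> exists2 s : R, 0 < s & forall t, P t s.
Proof.
move=> mono exs.
have [s sP] : {s : T -> R & forall t, 0 < s t /\ P t (s t)}.
  by apply: (@choice _ _ (fun t (s : R) => 0 < s /\ P t s)) => t; have [s] := exs t; exists s.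
exists (\big[Num.min/1]_t s t).
  by elim/big_ind : _ => // [x y x0 y0|t _]; [rewrite lt_min x0|case: (sP t)].
by move=> t; apply: mono (sP t).2; rewrite (bigD1 t)//= ge_min lexx.
Qed.

Lemma msupport_invariant {R : realType} {X : pmetricType R} (g : X -> X)
    (nu : probability (borel X) R) x :
  continuous g -> f_invariant g nu -> msupport nu x -> msupport nu (g x).
Proof.
move=> cg ig Sx V oV Vgx; rewrite -ig; last exact: measurable_borel_open.
by apply: Sx => //; apply: open_comp => // y _; exact: cg.
Qed.

(** Inner regularity with budget tau / #|B| per cell; finitely many disjoint closed sets in a
    compact space are at positive distance, which gives [d]. *)
Lemma closed_cores {R : realType} {X : pmetricType R} {B : finType}
    (nu : probability (borel X) R) (b : X -> B) (tau : R) :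
  compact [set: X] -> mlabel b -> 0 < tau ->
  exists (K : B -> set X) (d : R), [/\ 0 < d, forall j, closed (K j),
    forall j, K j `<=` b @^-1` [set j],
    prob nu [set x | ~ K (b x) x] <= tau &
    forall x y, K (b x) x -> K (b y) y -> dist x y < d -> b x = b y].
Proof.
move=> cX mb tau0.
pose k : R := #|B|%:R.
have k0 : 0 < k by rewrite ltr0n; apply/card_gt0P; exists (b point).
have tk : 0 < tau / k by rewrite divr_gt0.
have [K KP] : {K : B -> set X & forall j, [/\ closed (K j), K j `<=` b @^-1` [set j] &
    prob nu (b @^-1` [set j] `\` K j) < tau / k]}.
  apply: (@choice _ _ (fun j (K : set X) => [/\ closed K, K `<=` b @^-1` [set j] &
    prob nu (b @^-1` [set j] `\` K) < tau / k])) => j.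
  exact: prob_closed_approx.
have cK j : closed (K j) by case: (KP j).
have KB j : K j `<=` b @^-1` [set j] by case: (KP j).
have [d d0 dP] : exists2 d : R, 0 < d & forall t : B * B, t.1 != t.2 ->
    forall x y, K t.1 x -> K t.2 y -> d <= dist x y.
  apply: (@finite_uniform _ _ (fun (t : B * B) (d : R) => t.1 != t.2 ->
    forall x y, K t.1 x -> K t.2 y -> d <= dist x y)).
    by move=> t s s' ss h ne x y Kx Ky; exact: le_trans ss (h ne x y Kx Ky).
  move=> [i j] /=; have [_|ij] := eqVneq i j; first by exists 1.
  have Kij : K i `&` K j = set0.
    rewrite -subset0 => x [/KB /= bi /KB /= bj].
    by move: ij; rewrite -bi -bj eqxx.
  by have [s s0 sP] := closed_separation _ _ cX (cK i) (cK j) Kij; exists s.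
exists K, d; split => //.
  have mKj j : measurable (K j : set (borel X)) by exact: measurable_borel_closed.
  rewrite (_ : [set x | _] = [set x | exists2 j, xpredT j & (b @^-1` [set j] `\` K j) x]).
    rewrite prob_bigcup_fin; last 2 first.
    - by move=> j; apply: measurableD.
    - by move=> i j x [/= <- _] [/= <- _].
    apply: (@le_trans _ _ (\sum_(j : B) tau / k)).
      by apply: ler_sum => j _; apply: ltW; case: (KP j).
    by rewrite sumr_const -[_ *+ _]mulr_natl -/k mulrC divfK ?gt_eqF.
  apply/seteqP; split => [x /= nK|x /= [j _ [/= bj nKj]]]; first by exists (b x).
  by rewrite bj.
move=> x y Kx Ky xy; apply/eqP/negPn/negP => ne.
by have := dP (b x, b y) ne x y Kx Ky; rewrite leNgt xy.
Qed.

Lemma mlabel_cores {R : realType} {X : pmetricType R} {B : finType} (b : X -> B) (K : B -> set X) :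
  mlabel b -> (forall j, closed (K j)) -> mlabel (fun x => `[< K (b x) x >]).
Proof.
move=> mb cK.
have mK j : measurable (K j : set (borel X)) by exact: measurable_borel_closed.
have mT : measurable ([set x | K (b x) x] : set (borel X)).
  rewrite (_ : [set x | _] = \bigcup_(j in [set: B]) (b @^-1` [set j] `&` K j)).
    by apply: fin_bigcup_measurable => // j _; exact: measurableI.
  apply/seteqP; split => [x /= Kx|x [j _ [/= <-]]//]; by exists (b x).
case.
  rewrite (_ : _ @^-1` _ = [set x | K (b x) x])//.
  by apply/seteqP; split => x /= /asboolP.
rewrite (_ : _ @^-1` _ = ~` [set x | K (b x) x]); first exact: measurableC.
by apply/seteqP; split => x /= => [h /asboolP|/asboolF//]; rewrite h.
Qed.

(* At a given time, all points of an (n, d)-close set that lie in cores lie in the same core. *)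
Lemma few_words {R : realType} {X : pmetricType R} {A B : finType} (g : X -> X) (S : set X)
    (a : X -> A) (b : X -> B) (K : B -> set X) (e d M : R) n (q : {ffun 'I_n -> A}) :
  (forall x y, a x = a y -> dist x y <= e) -> 0 < d -> 0 <= M ->
  (forall x y, K (b x) x -> K (b y) y -> dist x y < d -> b x = b y) ->
  (forall x, S x -> ncover g (d / 2)
    [set z | forall i, (i < n)%N -> dist (iter i g z) (iter i g x) <= e] n M) ->
  exists s : seq {ffun 'I_n -> B}, (size s)%:R <= M /\
    forall x, S x -> name a g n x = q -> exists2 v, v \in s &
      forall i : 'I_n, K (b (iter i g x)) (iter i g x) -> v i = b (iter i g x).
Proof.
move=> ae d0 M0 Kd cov.
have [[x0 [Sx0 x0q]]|nx] := pselect (exists x, S x /\ name a g n x = q); last first.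
  by exists [::]; split => // x Sx xq; exfalso; apply: nx; exists x.
have [J [C [JM CA hC]]] := cov x0 Sx0.
(* Each piece gets one word, whose i-th letter is read at some point of the piece lying in a core at
   time i. If there is none, the letter given by the default of [get] is never tested. *)
pose good (i : 'I_n) j z := C j z /\ K (b (iter i g z)) (iter i g z).
pose W j : {ffun 'I_n -> B} := [ffun i : 'I_n => b (iter i g (get (good i j)))].
exists [seq W j | j <- enum J]; split; first by rewrite size_map -cardE.
(* Equal [a]-words put x in the Bowen ball of x0, because points in the same cell are at distance at
   most e. *)
move=> x Sx xq; have [|j Cj] := CA x.
  move=> i im; apply: ae; move: x0q; rewrite -xq => /ffunP/(_ (Ordinal im)).
  by rewrite !ffunE.
exists (W j); first by apply: map_f; rewrite mem_enum.
move=> i Ki; rewrite ffunE.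
have [Cz Kz] : good i j (get (good i j)) by apply: (@getI _ _ x).
apply: Kd => //; apply: le_lt_trans (hC j _ _ i Cz Cj (ltn_ord i)) _; lra.
Qed.

(** A product of probability vectors: at time i the letter [v i] flagged true has weight 1 - th, and
    each letter flagged false has weight th / #|B|. *)
Lemma sum_product_weights {R : realType} {B : finType} n (v : {ffun 'I_n -> B}) (th : R) :
  (0 < #|B|)%N ->
  \sum_(p : {ffun 'I_n -> B * bool}) \prod_i
    (if (p i).2 then (1 - th) * ((p i).1 == v i)%:R else th / #|B|%:R) = 1.
Proof.
move=> B0.
rewrite -(bigA_distr_bigA (fun (i : 'I_n) (s : B * bool) =>
  if s.2 then (1 - th) * (s.1 == v i)%:R else th / #|B|%:R)).
apply: big1 => i _.
rewrite -(pair_bigA _ (fun j (c : bool) => if c then (1 - th) * (j == v i)%:R else th / #|B|%:R))/=.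
under eq_bigr do rewrite big_bool/=.
rewrite big_split/= -mulr_sumr (bigD1 (v i))//= eqxx big1 ?addr0; last first.
  by move=> j /negbTE ->.
rewrite sumr_const mulr1 -[X in _ + X]mulr_natr divfK ?subrK//.
by rewrite pnatr_eq0 -lt0n.
Qed.

Lemma cellp_gt0_msupport {R : realType} {X : pmetricType R} {T : finType}
    (nu : probability (borel X) R) (F : X -> T) t :
  compact [set: X] -> mlabel F -> 0 < cellp nu F t -> exists2 x, msupport nu x & F x = t.
Proof.
move=> cX mF Ft; apply: contrapT => h; have [cS S0] := msupport_prob0 nu cX.
move: Ft; rewrite ltNge => /negP; apply; rewrite -S0; apply: prob_mono => //.
  by apply: measurable_borel_open; rewrite openC.
by move=> x /= Fx Sx; apply: h; exists x.
Qed.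

(** Given the [a]-word, the kernel picks one of at most M words v, then at each time either repeats
    the letter of v or, at times outside the cores, draws a uniform letter. Its mean cost is ln M,
    plus beta / 3 per time for the flags, plus [L] times the expected number of times outside the
    cores. *)
Lemma ent_comparison {R : realType} {X : pmetricType R} {A B : finType} (g : X -> X)
    (nu : probability (borel X) R) (a : X -> A) (b : X -> B) (e beta : R) :
  compact [set: X] -> is_homeo g -> f_invariant g nu ->
  (forall y, msupport nu y -> htop_set (Gamma e y g) g = 0%E) ->
  mlabel a -> mlabel b -> (forall x y, a x = a y -> dist x y <= e) -> 0 < beta ->
  exists C : R, forall n, ent nu (name b g n) <= ent nu (name a g n) + (C + n%:R * beta).
Proof.
move=> cX [cg [h [ch gh hg]]] ig h0 ma mb ae beta0.
have [cS S0] := msupport_prob0 nu cX.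
have gS x := msupport_invariant g nu x cg ig.
pose k : R := #|B|%:R.
have B0 : (0 < #|B|)%N by apply/card_gt0P; exists (b point).
have k1 : 1 <= k by rewrite ler1n.
have b3 : 0 < beta / 3 by lra.
(* Chosen so that - ln (1 - th) = beta / 3; below, [L] is the cost of one time outside the cores,
   and [tau] makes such times cost at most beta / 3 on average. *)
pose th := 1 - expR (- (beta / 3)).
have th0 : 0 < th by rewrite subr_gt0 expR_lt1 oppr_lt0.
have th1 : 0 < 1 - th by rewrite /th opprB addrC subrK expR_gt0.
have kth0 : 0 < th / k by rewrite divr_gt0//; lra.
pose L := - ln (th / k).
have L0 : 0 <= L.
  rewrite oppr_ge0 ln_le0// ler_pdivrMr ?mul1r; last lra.
  by apply: le_trans k1; rewrite lerBlDr lerDl expR_ge0.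
pose tau := beta / 3 / (L + 1).
have L1 : 0 < L + 1 by lra.
have tau0 : 0 < tau by rewrite divr_gt0.
have Ltau : L * tau <= beta / 3.
  by rewrite mulrC /tau mulrAC ler_pdivrMr// ler_pM2l//; lra.
have [K [d [d0 cK KB Ktau Kd]]] := closed_cores nu b tau cX mb tau0.
have d2 : 0 < d / 2 by lra.
have [c c0 cP] := bowen_ball_cover _ _ _ _ _ _ cX cg ch gh hg cS gS h0 d2 b3.
exists (ln c) => n.
pose M := c * expR (beta / 3 * n%:R).
have M0 : 0 < M by rewrite mulr_gt0// expR_gt0.
pose good x := `[< K (b x) x >].
have mgood : mlabel good := mlabel_cores b K mb cK.
pose b' x := (b x, good x).
have mb' : mlabel b' by exact: mlabel_pair.
pose F x := (name b' g n x, name a g n x).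
have mF : mlabel F by apply: mlabel_pair; exact: mlabel_name.
have [s sP] : {s : {ffun 'I_n -> A} -> seq {ffun 'I_n -> B} & forall q, (size (s q))%:R <= M /\
    forall x, msupport nu x -> name a g n x = q -> exists2 v, v \in s q &
      forall i : 'I_n, K (b (iter i g x)) (iter i g x) -> v i = b (iter i g x)}.
  apply: (@choice _ _ (fun q (s : seq {ffun 'I_n -> B}) => (size s)%:R <= M /\
    forall x, msupport nu x -> name a g n x = q -> exists2 v, v \in s &
      forall i : 'I_n, K (b (iter i g x)) (iter i g x) -> v i = b (iter i g x))) => q.
  exact: (few_words g (msupport nu) a b K e d M n q ae d0 (ltW M0) Kd (cP n)).
pose G (v : {ffun 'I_n -> B}) (i : 'I_n) (u : B * bool) : R :=
  if u.2 then (1 - th) * (u.1 == v i)%:R else th / k.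
have G0 v i u : 0 <= G v i u.
  by rewrite /G; case: ifP => _; [rewrite mulr_ge0// ltW|exact: ltW].
have PG0 v (p : {ffun 'I_n -> B * bool}) : 0 <= \prod_i G v i (p i) by exact: prodr_ge0.
pose w (t : {ffun 'I_n -> B * bool} * {ffun 'I_n -> A}) : R :=
  M^-1 * \sum_(v <- s t.2) \prod_i G v i (t.1 i).
have w0 t : 0 <= w t by rewrite mulr_ge0 ?invr_ge0 ?(ltW M0)// sumr_ge0.
pose bad (t : {ffun 'I_n -> B * bool} * {ffun 'I_n -> A}) : R := \sum_i (~~ (t.1 i).2)%:R.
(* A cell of positive mass contains a point of the support, and one word of [few_words] agrees with
   it at all times in the cores; the term of that word alone gives the bound. *)
have wlow t : 0 < cellp nu F t -> M^-1 * expR (- (n%:R * (beta / 3) + L * bad t)) <= w t.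
  move=> /(cellp_gt0_msupport nu F t cX mF)[x Sx Fx].
  have [_ /(_ x Sx)] := sP t.2; rewrite -Fx => /(_ erefl)[v vs vP].
  rewrite ler_pM2l ?invr_gt0//=.
  apply: (@le_trans _ _ (\prod_i G v i ((F x).1 i))); last first.
    by rewrite (big_rem v vs)/= lerDl sumr_ge0.
  have -> : - (n%:R * (beta / 3) + L * bad (F x)) =
      \sum_(i < n) (- (beta / 3) - L * (~~ ((F x).1 i).2)%:R).
    by rewrite sumrB -mulr_sumr sumr_const card_ord mulNrn -[beta / 3 *+ n]mulr_natl opprD /bad.
  rewrite expR_sum; apply: ler_prod => i _; rewrite expR_ge0/= /F/= ffunE /b' /G/=.
  case: ifPn => [/asboolP gi|_].
    rewrite vP// eqxx mulr1 mulr0 subr0 /th; lra.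
  by rewrite mulr1 -[leRHS](lnK (x := th / k)) ?posrE// ler_expR /L; lra.
have w1 q : \sum_(t | t.2 == q) w t <= 1.
  rewrite (reindex_onto (fun p => (p, q)) fst) /=; last by move=> [? ?] /= /eqP ->.
  rewrite (eq_bigl xpredT); last by move=> p; rewrite !eqxx.
  rewrite /w /= -mulr_sumr exchange_big/= (eq_bigr (fun=> 1)); last first.
    by move=> v _; exact: sum_product_weights.
  rewrite big_const_seq count_predT iter_addr_0 mulrC ler_pdivrMr// mul1r.
  by case: (sP q).
have wpos t : 0 < cellp nu F t -> 0 < w t.
  by move=> /wlow; apply: lt_le_trans; rewrite mulr_gt0 ?invr_gt0 ?expR_gt0.
pose fstw (t : {ffun 'I_n -> B * bool} * {ffun 'I_n -> A}) := [ffun i : 'I_n => (t.1 i).1].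
have -> : name b g n = fstw \o F by apply/funext => x; apply/ffunP => i; rewrite !ffunE.
have -> : name a g n = snd \o F by [].
apply: le_trans (ent_gibbs nu F fstw snd w mF w0 wpos w1) _; rewrite lerD2l.
have term t : cellp nu F t * - ln (w t) <=
    cellp nu F t * (ln M + n%:R * (beta / 3)) + L * (\sum_i cellp nu F t * (~~ (t.1 i).2)%:R).
  have := cellp_ge0 nu F t; rewrite le_eqVlt => /predU1P[<-|Ft].
    by rewrite !mul0r add0r big1 ?mulr0// => i _; rewrite mul0r.
  rewrite -mulr_sumr [L * (_ * _)]mulrCA -mulrDr ler_pM2l// lerNl.
  apply: le_trans (_ : ln (M^-1 * expR (- (n%:R * (beta / 3) + L * bad t))) <= _); last first.
    by rewrite ler_ln ?posrE ?wpos ?mulr_gt0 ?invr_gt0 ?expR_gt0//; exact: wlow.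
  by rewrite [ln (M^-1 * _)]lnM ?posrE ?invr_gt0 ?expR_gt0// lnV ?posrE// expRK -/(bad t); lra.
apply: le_trans (ler_sum _ (fun t _ => term t)) _.
rewrite big_split/= -mulr_suml cellp_sum1// mul1r -mulr_sumr exchange_big/=.
(* By invariance the orbit is outside the cores at time i with the same probability as at time 0. *)
have badi (i : 'I_n) : \sum_(t : {ffun 'I_n -> B * bool} * {ffun 'I_n -> A}) cellp nu F t * (~~ (t.1 i).2)%:R <= tau.
  have -> : \sum_(t : {ffun 'I_n -> B * bool} * {ffun 'I_n -> A}) cellp nu F t * (~~ (t.1 i).2)%:R = \sum_(t : {ffun 'I_n -> B * bool} * {ffun 'I_n -> A} | ~~ (t.1 i).2) cellp nu F t.
    by rewrite [RHS]big_mkcond/=; apply: eq_bigr => t _; case: (t.1 i).2; rewrite ?mulr0 ?mulr1.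
  rewrite -(prob_preimage nu F (fun t : {ffun 'I_n -> B * bool} * {ffun 'I_n -> A} => ~~ (t.1 i).2) mF); apply: le_trans Ktau.
  rewrite le_eqVlt; apply/orP; left; apply/eqP.
  have mbad : measurable ([set x | ~ K (b x) x] : set (borel X)).
    have := mgood false; congr (measurable _).
    by apply/seteqP; split => x /= => [h1 /asboolP|/asboolF//]; rewrite -/(good x) h1.
  rewrite -[RHS](_ : fine (nu (iter i g @^-1` [set x | ~ K (b x) x])) = _); last first.
    by rewrite (iter_invariant g nu _ i cg ig mbad).
  congr (fine (nu _)); apply/seteqP; split => x /=; rewrite ffunE /=.
    by move/asboolPn.
  by move=> nK; apply/asboolPn.
apply: (@le_trans _ _ (ln M + n%:R * (beta / 3) + L * \sum_(i < n) tau)).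
  by rewrite lerD2l ler_wpM2l// ler_sum.
rewrite sumr_const card_ord -[tau *+ n]mulr_natl mulrCA /M lnM ?posrE ?expR_gt0// expRK.
have : n%:R * (L * tau) <= n%:R * (beta / 3) by rewrite ler_wpM2l.
lra.
Qed.

Lemma ent_limit_comparison {R : realType} {X : pmetricType R} {A B : finType} (g : X -> X)
    (nu : probability (borel X) R) (a : X -> A) (b : X -> B) (e : R) :
  compact [set: X] -> is_homeo g -> f_invariant g nu ->
  (forall y, msupport nu y -> htop_set (Gamma e y g) g = 0%E) ->
  mlabel a -> mlabel b -> (forall x y, a x = a y -> dist x y <= e) ->
  limn (fun n => n%:R^-1 * ent nu (name b g n)) <= limn (fun n => n%:R^-1 * ent nu (name a g n)).
Proof.
move=> cX hg ig h0 ma mb ae; have [cg _] := hg.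
have [ca _] := ent_name_limit nu a g cg ig ma.
have [cb _] := ent_name_limit nu b g cg ig mb.
suff H (t : R) : 0 < t -> limn (fun n => n%:R^-1 * ent nu (name b g n)) <=
    limn (fun n => n%:R^-1 * ent nu (name a g n)) + t by apply/ler_addgt0Pr => t; exact: H.
move=> t0; have t2 : 0 < t / 2 by lra.
have [C CP] := ent_comparison g nu a b e _ cX hg ig h0 ma mb ae t2.
have cat : (fun n => n%:R^-1 * ent nu (name a g n) + t) @ \oo -->
    limn (fun n => n%:R^-1 * ent nu (name a g n)) + t by apply: cvgD => //; exact: cvg_cst.
apply: (ler_cvg_to cb cat).
near=> n.
have n0 : (0 < n)%N by near: n; exists 1%N.
have nR : 0 < n%:R :> R by rewrite ltr0n.
have Cn : n%:R^-1 * C <= t / 2.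
  rewrite mulrC ler_pdivrMr// mulrC -ler_pdivrMr//.
  near: n; exact: nbhs_infty_ger.
have h : n%:R^-1 * ent nu (name b g n) <= n%:R^-1 * (ent nu (name a g n) + (C + n%:R * (t / 2))).
  by rewrite ler_pM2l ?invr_gt0.
apply: le_trans h _; rewrite !mulrDr mulKf ?gt_eqF//=; lra.
Unshelve. all: by end_near.
Qed.

(** * Perturbation of a partition *)

Lemma prob_bigsetU_le {R : realType} {X : pmetricType R} {I : Type} (nu : probability (borel X) R)
    (r : seq I) (A : I -> set X) : (forall i, measurable (A i : set (borel X))) ->
  prob nu (\big[setU/set0]_(i <- r) A i) <= \sum_(i <- r) prob nu (A i).
Proof.
move=> mA; elim: r => [|i r ih]; first by rewrite !big_nil /prob measure0.
rewrite !big_cons; apply: le_trans (prob_setU_le nu _ _ (mA i) _) _; last by rewrite lerD2l.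
exact: bigsetU_measurable.
Qed.

Lemma label_partition {R : realType} {X : pmetricType R} {T : finType} (F : X -> T) :
  mlabel F -> finite_partition [seq F @^-1` [set t] | t <- enum T].
Proof.
move=> mF; have x0 := F point; split; rewrite size_map.
- by move=> i il; rewrite (nth_map x0 set0 _ il); exact: mF.
- move=> i j il jl ij; rewrite (nth_map x0 set0 _ il) (nth_map x0 set0 _ jl); apply/seteqP; split => // x [/= Fi Fj].
  apply: ij; apply/eqP; rewrite -(nth_uniq x0 il jl (enum_uniq T)).
  by rewrite -Fi -Fj.
- apply/seteqP; split => // x _.
  have xl : (index (F x) (enum T) < size (enum T))%N by rewrite index_mem mem_enum.
  by exists (index (F x) (enum T)) => //; rewrite (nth_map x0 set0 _ xl) /= nth_index// mem_enum.
Qed.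

(** Cells record membership in each ball of radius r / 2 of a finite cover, so two points of a cell
    share a ball. *)
Lemma small_partition {R : realType} {X : pmetricType R} (r : R) :
  compact [set: X] -> 0 < r -> exists xi : seq (set X), finite_partition xi /\
    forall j x y, (j < size xi)%N -> nth set0 xi j x -> nth set0 xi j y -> dist x y <= r.
Proof.
move=> cX r0; have r2 : 0 < r / 2 by lra.
have [s sP] := compact_finite_net _ cX r2.
pose b (i : 'I_(size s)) (x : X) := dist (nth point s i) x < r / 2.
have oB i : open [set x | b i x].
  apply/open_dist => y /= xy; exists (r / 2 - dist (nth point s i) y).
    by rewrite subr_gt0.
  by move=> z yz; rewrite /b; have := dist_triangle y (nth point s i) z; lra.
have mb i : mlabel (b i).
  case; first by rewrite (_ : _ @^-1` _ = [set x | b i x])//; exact: measurable_borel_open.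
  rewrite (_ : _ @^-1` _ = ~` [set x | b i x]).
    by apply: measurableC; exact: measurable_borel_open.
  by apply/seteqP; split => x /= => [->//|/negP/negbTE].
pose F x := [ffun i => b i x].
have mF : mlabel F by exact: mlabel_ffun.
exists [seq F @^-1` [set t] | t <- enum {ffun 'I_(size s) -> bool}]; split.
  exact: label_partition.
move=> j x y; rewrite size_map => jl; rewrite (nth_map (F point) set0 _ jl) /= => Fx Fy.
have [c cs cx] := sP x; have ci : (index c s < size s)%N by rewrite index_mem.
have : F x (Ordinal ci) = F y (Ordinal ci) by rewrite Fx Fy.
rewrite !ffunE /b/= nth_index// cx => /esym cy.
have := dist_triangle c x y; rewrite (dist_sym x c); lra.
Qed.

(** * Test functions and thickened labels *)

Lemma integ_le_prob {R : realType} {X : pmetricType R} (nu : probability (borel X) R)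
    (Y A : set X) (phi : X -> R) :
  measurable (Y : set (borel X)) -> measurable (A : set (borel X)) ->
  measurable_fun (setT : set (borel X)) (phi : borel X -> R) ->
  (forall x, 0 <= phi x <= 1) -> (forall x, 0 < phi x -> A x) ->
  (integ nu Y phi <= (prob nu A)%:E)%E.
Proof.
move=> mY mA mphi phi01 phiA; rewrite -probE// /integ.
apply: (@le_trans _ _ (\int[nu]_(x in (Y : set (borel X))) (\1_A x)%:E)%E).
  apply: ge0_le_integral => //.
  - by move=> x _; rewrite lee_fin; case/andP: (phi01 x).
  - by apply/measurable_EFinP; exact: measurable_funS mphi.
  - by apply/measurable_EFinP; exact: measurable_indic.
  - move=> x _; rewrite lee_fin indicE; have /andP[p0 p1] := phi01 x.
    have [xA|xA] := boolP (x \in A); first exact: p1.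
    rewrite leNgt; apply/negP => /phiA Ax; move/negP: xA; apply; exact/mem_set.
rewrite integral_indic//; apply: le_measure; rewrite ?inE//; exact: measurableI.
Qed.

Lemma prob_le_integ {R : realType} {X : pmetricType R} (nu : probability (borel X) R)
    (Y C : set X) (phi : X -> R) :
  measurable (Y : set (borel X)) -> measurable (C : set (borel X)) ->
  measurable_fun (setT : set (borel X)) (phi : borel X -> R) ->
  (forall x, 0 <= phi x) -> (forall x, C x -> phi x = 1) -> prob nu (~` Y) = 0 ->
  ((prob nu C)%:E <= integ nu Y phi)%E.
Proof.
move=> mY mC mphi phi0 phiC Y0.
apply: (@le_trans _ _ (\int[nu]_(x in (Y : set (borel X))) (\1_C x)%:E)%E); last first.
  apply: ge0_le_integral => //.
  - by apply/measurable_EFinP; exact: measurable_indic.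
  - by apply/measurable_EFinP; exact: measurable_funS mphi.
  - move=> x _; rewrite lee_fin indicE.
    by have [/set_mem/phiC ->|_] := boolP (x \in C).
rewrite integral_indic//; apply: (@le_trans _ _ (prob nu (C `&` Y))%:E); last first.
  by rewrite -(probE nu _ (measurableI _ _ mC mY)).
rewrite lee_fin -[leRHS]addr0 -Y0.
apply: le_trans (prob_setU_le nu _ _ _ (measurableC mY)); last exact: measurableI.
apply: prob_mono => //; first by apply: measurableU; [exact: measurableI|exact: measurableC].
by move=> x Cx; have [Yx|nYx] := pselect (Y x); [left|right].
Qed.

Lemma continuous_borel_measurable {R : realType} {X : pmetricType R} (phi : X -> R) :
  continuous phi -> measurable_fun (setT : set (borel X)) (phi : borel X -> R).
Proof.
move=> cphi; apply: (measurability _ (RGenOpens.measurableE R)) => _ [_ [a [b ->]] <-].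
rewrite setTI; apply: measurable_borel_open; apply: open_comp; last exact: interval_open.
by move=> x _; exact: cphi.
Qed.

(** Points within [s] of a core take the label of that core, which makes labels near cores stable
    under perturbation. The point picked by [get] does not matter once distinct cores are at least 2
    s apart. *)
Definition thicken {R : realType} {X : pmetricType R} {A : finType}
    (a : X -> A) (K : A -> set X) (s : R) (x : X) : A :=
  if `[< exists y, K (a y) y /\ dist x y < s >]
  then a (get [set y | K (a y) y /\ dist x y < s]) else a x.

Lemma thicken_near {R : realType} {X : pmetricType R} {A : finType}
    (a : X -> A) (K : A -> set X) (s : R) (x y : X) :
  (forall x y, K (a x) x -> K (a y) y -> dist x y < s + s -> a x = a y) ->
  K (a y) y -> dist x y < s -> thicken a K s x = a y.
Proof.
move=> sep Ky xy; rewrite /thicken; case: asboolP => [ex|]; last by case; exists y.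
have [Kz xz] : [set y | K (a y) y /\ dist x y < s] (get [set y | K (a y) y /\ dist x y < s]).
  exact: (@getI _ _ y).
apply: sep => //; move: xz; set z := get _ => xz.
have := dist_triangle x z y; rewrite (dist_sym z x); lra.
Qed.

Lemma thicken_far {R : realType} {X : pmetricType R} {A : finType}
    (a : X -> A) (K : A -> set X) (s : R) (x : X) :
  (forall y, K (a y) y -> ~ dist x y < s) -> thicken a K s x = a x.
Proof. by move=> far; rewrite /thicken; case: asboolP => // ex; case: ex => y [Ky xy]; case: (far y Ky xy). Qed.

(** Each new cell lies within s of the old one, so diameters grow by at most 2 s. *)
Lemma thicken_close {R : realType} {X : pmetricType R} {A : finType}
    (a : X -> A) (K : A -> set X) (s : R) (x : X) : 0 < s ->
  exists2 y, a y = thicken a K s x & dist x y < s.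
Proof.
move=> s0; rewrite /thicken; case: asboolP => [ex|_]; last by exists x; rewrite ?distxx.
have [_ xz] : [set y | K (a y) y /\ dist x y < s] (get [set y | K (a y) y /\ dist x y < s]).
  by have [y Ky] := ex; exact: (@getI _ _ y).
by eexists; last exact: xz.
Qed.

(** The cell of j is the open s-neighbourhood of its core together with the part of the old cell off
    all such neighbourhoods. *)
Lemma mlabel_thicken {R : realType} {X : pmetricType R} {A : finType}
    (a : X -> A) (K : A -> set X) (s : R) : mlabel a ->
  (forall j, K j `<=` a @^-1` [set j]) ->
  (forall x y, K (a x) x -> K (a y) y -> dist x y < s + s -> a x = a y) ->
  mlabel (thicken a K s).
Proof.
move=> ma Ka sep j.
pose N i : set X := [set x | exists2 y, K i y & dist x y < s].
have oN i : open (N i).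
  apply/open_dist => x [y Ky xy]; exists (s - dist x y); first by rewrite subr_gt0.
  move=> z xz; exists y => //; have := dist_triangle x z y; rewrite (dist_sym z x); lra.
have mN i : measurable (N i : set (borel X)) by exact: measurable_borel_open.
rewrite (_ : _ @^-1` _ = N j `|` (a @^-1` [set j] `\` \bigcup_(i in [set: A]) N i)).
  apply: measurableU => //; apply: measurableD; first exact: ma.
  exact: fin_bigcup_measurable.
have nearN x y : K (a y) y -> dist x y < s -> thicken a K s x = a y by exact: thicken_near.
apply/seteqP; split => [x /= tx|x [[y Ky xy]|[/= ax nN]] /=].
- have [[y [Ky xy]]|h] := pselect (exists y, K (a y) y /\ dist x y < s).
    by left; exists y => //; rewrite -tx (nearN x y).
  right; have far : thicken a K s x = a x.
    by apply: thicken_far => y Ky xy; apply: h; exists y.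
  split; first by rewrite /= -far.
  move=> [i _ [y Ky xy]]; apply: h; exists y; split => //.
  by have /= -> := Ka i y Ky.
- by have /= ay := Ka j y Ky; rewrite (nearN x y)// ay.
- by rewrite thicken_far// => y Ky xy; apply: nN; exists (a y) => //; exists y.
Qed.

Lemma iter_uniform_continuity {R : realType} {X : pmetricType R} (f : X -> X) n (e : R) :
  compact [set: X] -> continuous f -> 0 < e ->
  exists2 d : R, 0 < d & forall (i : 'I_n) x y, dist x y < d -> dist (iter i f x) (iter i f y) < e.
Proof.
move=> cX cf e0; apply: (@finite_uniform _ _ (fun (i : 'I_n) (d : R) =>
  forall x y, dist x y < d -> dist (iter i f x) (iter i f y) < e)).
  by move=> i s s' ss h x y xy; apply: h; exact: lt_le_trans xy ss.
by move=> i; apply: compact_uniform_continuity => //; exact: continuous_iter.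
Qed.

(** A point with word k that is not in [C] leaves the cores at some time below n; invariance and a
    union bound give n tau. As [C] is closed, it admits a test function. *)
Lemma cores_word_prob {R : realType} {X : pmetricType R} {A : finType} (f : X -> X)
    (mu : probability (borel X) R) (a : X -> A) (K : A -> set X) (tau : R) n (k : {ffun 'I_n -> A}) :
  continuous f -> f_invariant f mu -> mlabel a -> (forall j, closed (K j)) ->
  prob mu [set x | ~ K (a x) x] <= tau ->
  let C := [set x | forall i : 'I_n, K (k i) (iter i f x)] in
  closed C /\ cellp mu (name a f n) k <= prob mu C + n%:R * tau.
Proof.
move=> cf fi ma cK Ktau C.
have cC : closed C.
  rewrite (_ : C = \bigcap_(i in [set: 'I_n]) (iter i f @^-1` K (k i))).
    apply: closed_bigI => i _; apply: closed_comp => // x _; exact: continuous_iter.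
  by apply/seteqP; split => x /= h i; [move=> _; exact: h|exact: h].
split => //.
have mbad : measurable ([set x | ~ K (a x) x] : set (borel X)).
  have := mlabel_cores a K ma cK false; congr (measurable _).
  by apply/seteqP; split => x /= => [h1 /asboolP|/asboolF//]; rewrite h1.
have mC : measurable (C : set (borel X)) by exact: measurable_borel_closed.
pose Bad (i : 'I_n) : set X := iter i f @^-1` [set x | ~ K (a x) x].
have mBad i : measurable (Bad i : set (borel X)).
  by apply: measurable_borel_preimage => //; exact: continuous_iter.
have mBU : measurable (\big[setU/set0]_(i < n) Bad i : set (borel X)).
  by apply: bigsetU_measurable => i _; exact: mBad.
apply: (@le_trans _ _ (prob mu (C `|` \big[setU/set0]_(i < n) Bad i))).
  apply: prob_mono; [exact: mlabel_name|exact: measurableU|].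
  move=> x /= xk; have [Cx|nCx] := pselect (C x); [by left|right].
  have [i nKi] : exists i : 'I_n, ~ K (k i) (iter i f x) by exact/existsNP.
  rewrite -bigcup_seq; exists i; first by rewrite /= mem_index_enum.
  by move: nKi; rewrite -xk ffunE.
apply: le_trans (prob_setU_le mu _ _ mC mBU) _; rewrite lerD2l.
apply: le_trans (prob_bigsetU_le mu _ _ mBad) _.
apply: (@le_trans _ _ (\sum_(i < n) tau)); last by rewrite sumr_const card_ord mulr_natl.
apply: ler_sum => i _; apply: le_trans Ktau.
by rewrite le_eqVlt /prob (iter_invariant f mu _ i cf fi mbad) eqxx.
Qed.

(** For each word k a test function equals 1 on the closed set [C k] and is positive only where
    g-orbits stay s-close to the cores of k, hence have thickened word k. So the nu-mass of the new
    cell is at least the mu-mass of the old one minus [kap], and [entropy_lower_close] applies. *)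
Lemma entropy_perturbation {R : realType} {X : pmetricType R} {A : finType} (Y : set X)
    (f : X -> X) (mu : probability (borel X) R) (a : X -> A) n (r e : R) :
  compact [set: X] -> closed Y -> continuous f -> f_invariant f mu -> prob mu (~` Y) = 0 ->
  mlabel a -> 0 < r -> 0 < e ->
  exists2 delta : R, 0 < delta &
  exists (k : nat) (phi : nat -> X -> R) (eta : R),
    [/\ 0 < eta, forall i, continuous (phi i) &
        exists a' : X -> A, [/\ mlabel a',
          forall x, exists2 y, a y = a' x & dist x y < r &
          forall (g : X -> X) (nu : probability (borel X) R),
            continuous g -> (forall x, dist (g x) (f x) < delta) ->
            (forall i, (i < k)%N ->
               (`| integ nu Y (phi i) - integ mu Y (phi i) | < eta%:E)%E) ->
            ent nu (name a' g n) <= ent mu (name a f n) + e]].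
Proof.
move=> cX cY cf fi Y0 ma r0 e0.
have mY : measurable (Y : set (borel X)) by exact: measurable_borel_closed.
have mN := mlabel_name a f n cf ma.
have [kap kap0 kapP] := entropy_lower_close _ _ (cellp_ge0 mu (name a f n)) (cellp_sum1 mu _ mN) e0.
(* Half of [kap] pays for the mass outside the cores over n times, the other half is [eta]; the
   successor avoids division by 0. *)
pose tau := kap / 2 / n.+1%:R.
have tau0 : 0 < tau by rewrite !divr_gt0// ltr0n.
have ntau : n%:R * tau <= kap / 2.
  rewrite mulrC /tau mulrAC ler_pdivrMr ?ltr0n// ler_wpM2l ?ler_nat//; lra.
have [K [d [d0 cK Ka Ktau sep]]] := closed_cores mu a tau cX ma tau0.
pose s := Num.min (d / 2) r.
have s0 : 0 < s by rewrite lt_min r0 andbT; lra.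
have sd : s <= d / 2 by rewrite ge_min lexx.
have sr : s <= r by rewrite ge_min lexx orbT.
have sep' x y : K (a x) x -> K (a y) y -> dist x y < s + s -> a x = a y.
  by move=> Kx Ky xy; apply: sep => //; lra.
(* One half of s for moving the starting point under f, one half for replacing f by g. *)
have s2 : 0 < s / 2 by lra.
have [s' s'0 s'P] := iter_uniform_continuity f n _ cX cf s2.
have [delta delta0 deltaP] := iter_perturbation f n _ cX cf s2.
exists delta => //.
pose T := {ffun 'I_n -> A}.
pose C (k : T) := [set x | forall i : 'I_n, K (k i) (iter i f x)].
have CP k := cores_word_prob f mu a K tau n k cf fi ma cK Ktau.
have [Phi PhiP] : {Phi : T -> X -> R & forall k, [/\ continuous (Phi k),
    forall x, 0 <= Phi k x <= 1, forall x, C k x -> Phi k x = 1 &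
    forall x, 0 < Phi k x -> exists2 c, C k c & dist x c < s']}.
  apply: (@choice _ _ (fun (k : T) (phi : X -> R) => [/\ continuous phi,
    forall x, 0 <= phi x <= 1, forall x, C k x -> phi x = 1 &
    forall x, 0 < phi x -> exists2 c, C k c & dist x c < s'])) => k.
  exact: urysohn_dist.
exists #|T|, (fun i => Phi (nth (name a f n point) (enum T) i)), (kap / 2); split.
- by lra.
- by move=> i; case: (PhiP (nth (name a f n point) (enum T) i)).
have ma' := mlabel_thicken a K s ma Ka sep'.
exists (thicken a K s); split => //.
  by move=> x; have [y ay xy] := thicken_close a K s x s0; exists y => //; exact: lt_le_trans xy sr.
move=> g nu cg gf close.
have mN' := mlabel_name (thicken a K s) g n cg ma'.
apply: kapP; [exact: cellp_ge0|exact: cellp_sum1|move=> k].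
have [cPhi Phi01 PhiC Phipos] := PhiP k.
have mPhi := continuous_borel_measurable (Phi k) cPhi.
have [cC Ck] := CP k.
have mC : measurable (C k : set (borel X)) by exact: measurable_borel_closed.
have hnu : (integ nu Y (Phi k) <= (cellp nu (name (thicken a K s) g n) k)%:E)%E.
  apply: integ_le_prob => //.
  move=> x /Phipos[c Cc xc]; apply/ffunP => i; rewrite ffunE.
  have Kc := Cc i; have /= ac := Ka _ _ Kc.
  rewrite (thicken_near _ _ _ _ (iter i f c))//; first by rewrite ac.
  have := deltaP g gf i x (ltnW (ltn_ord i)); have := s'P i x c xc.
  have := dist_triangle (iter i f x) (iter i g x) (iter i f c); lra.
have hmu : ((prob mu (C k))%:E <= integ mu Y (Phi k))%E.
  by apply: prob_le_integ => // x; case/andP: (Phi01 x).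
have hmu1 : (integ mu Y (Phi k) <= 1%:E)%E.
  rewrite -(prob_setT mu); apply: integ_le_prob => //.
have nu0 : (0 <= integ nu Y (Phi k))%E.
  by apply: integral_ge0 => x _; rewrite lee_fin; case/andP: (Phi01 x).
have ki : (index k (enum T) < #|T|)%N by rewrite cardE index_mem mem_enum.
have := close _ ki; rewrite nth_index ?mem_enum//.
(* The bounds exclude infinite values of both integrals and leave an inequality between reals. *)
move: hnu hmu hmu1 nu0 Ck.
case: (integ nu Y (Phi k)) => [p| |] //; case: (integ mu Y (Phi k)) => [q| |] //.
rewrite -EFinB abse_EFin !lte_fin !lee_fin ltr_norml -/(C k) => ? ? ? ? ? /andP[? ?].
lra.
Qed.

(** * Upper semicontinuity of the metric entropy *)

Lemma entropy_partition_label {R : realType} {X : pmetricType R} (xi : seq (set X)) :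
  finite_partition xi -> exists a : X -> 'I_(size xi),
    [/\ mlabel a, forall x, nth set0 xi (a x) x &
        forall (nu : probability (borel X) R) g,
          entropy_partition nu g xi = limn (fun n => n%:R^-1 * ent nu (name a g n))].
Proof.
move=> /finite_partition_label[a [ma aP aE]]; exists a; split => // nu g.
by rewrite /entropy_partition; congr (limn _); apply/funext => n; rewrite aE.
Qed.

Theorem mainTheorem14 (R : realType) (X : pmetricType R) (Y : set X)
    (U : set (X -> X)) (f : X -> X) (mu : probability (borel X) R) :
  compact [set: X] -> finite_dimensional X -> compact Y ->
  (forall g, U g -> is_homeo g) ->
  uniformly_h_expansive U Y ->
  U f -> f_invariant f mu -> msupport mu `<=` Y ->
  forall eps : R, 0 < eps ->
  (* an open neighbourhood of f in C^0(X,X) with the uniform topology *)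
  exists2 delta : R, 0 < delta &
  (* an open neighbourhood of mu in P(Y) with the weak* topology *)
  exists (k : nat) (phi : nat -> X -> R) (eta : R),
    [/\ 0 < eta,
        forall i, (i < k)%N -> {within Y, continuous phi i} &
        forall (g : X -> X) (nu : probability (borel X) R),
          U g -> (forall x, dist (g x) (f x) < delta) ->
          f_invariant g nu -> msupport nu `<=` Y ->
          (forall i, (i < k)%N ->
             (`| integ nu Y (phi i) - integ mu Y (phi i) | < eta%:E)%E) ->
          (ks_entropy nu g <= ks_entropy mu f + eps%:E)%E].
Proof.
move=> cX _ cptY homU [e0 e00 hexp] Uf fi suppY eps eps0.
have [cf _] := homU f Uf.
have cY : closed Y by apply: compact_closed cptY; exact: metric_hausdorff.
have mY : measurable (Y : set (borel X)) by exact: measurable_borel_closed.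
have Y0 : prob mu (~` Y) = 0.
  have [cS S0] := msupport_prob0 mu cX.
  apply/le_anti; rewrite prob_ge0 andbT -S0; apply: prob_mono.
  - exact: measurableC.
  - by apply: measurable_borel_open; rewrite openC.
  - exact: subsetC.
(* Cells of diameter e0 / 2 thickened by e0 / 4 on either side have diameter at most e0. *)
have e02 : 0 < e0 / 2 by lra.
have e04 : 0 < e0 / 4 by lra.
have [xi [pxi dxi]] := small_partition _ cX e02.
have [a [ma aP aE]] := entropy_partition_label xi pxi.
have [ca _] := ent_name_limit mu a f cf fi ma.
have eps2 : 0 < eps / 2 by lra.
have [n n0 nP] : exists2 n, (0 < n)%N &
    n%:R^-1 * ent mu (name a f n) <= entropy_partition mu f xi + eps / 2.
  move/cvgrPdist_le : ca => /(_ _ eps2)[N _ /(_ N.+1 (leqnSn N))] /=.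
  by rewrite aE ler_norml lerBrDr addrC lerBlDr => /andP[h _]; exists N.+1.
have nR : 0 < n%:R :> R by rewrite ltr0n.
(* The tolerance n eps / 2 for the entropy at time n becomes eps / 2 after division by n. *)
have [delta delta0 [k [phi [eta [eta0 cphi [a' [ma' a'a a'P]]]]]]] :=
  entropy_perturbation Y f mu a n _ _ cX cY cf fi Y0 ma e04 (mulr_gt0 nR eps2).
exists delta => //; exists k, phi, eta; split => //.
  by move=> i _; apply: continuous_subspaceT; exact: cphi.
move=> g nu Ug gf gi nuY close.
have hg := homU g Ug; have [cg _] := hg.
have a'e x y : a' x = a' y -> dist x y <= e0.
  move=> xy; have [x' ax' xx'] := a'a x; have [y' ay' yy'] := a'a y.
  have : dist x' y' <= e0 / 2.
    by apply: (dxi (a x')) => //; rewrite ax' xy -ay'.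
  have := dist_triangle x' x y; have := dist_triangle y' x' y; rewrite (dist_sym y' y); lra.
have h0 y : msupport nu y -> htop_set (Gamma e0 y g) g = 0%E by move=> /nuY; exact: hexp.
apply: ge_ereal_sup => _ [zeta pzeta <-].
have [b [mb _ bE]] := entropy_partition_label zeta pzeta.
apply: (@le_trans _ _ ((entropy_partition mu f xi)%:E + eps%:E)%E); last first.
  by apply: leeD2r; apply: ereal_sup_ubound; exists xi.
rewrite -EFinD lee_fin bE.
(* The arbitrary partition is replaced by the single label [a'], whose entropy rate is then bounded
   by its value at the one time n. *)
apply: le_trans (ent_limit_comparison g nu a' b e0 cX hg gi h0 ma' mb a'e) _.
have [_ /(_ n n0) lim_le] := ent_name_limit nu a' g cg gi ma'.
apply: le_trans lim_le _.
have : n%:R^-1 * ent nu (name a' g n) <= n%:R^-1 * ent mu (name a f n) + eps / 2.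
  rewrite -[eps / 2](mulKf (lt0r_neq0 nR)) -mulrDr ler_pM2l ?invr_gt0//.
  exact: a'P.
by move: nP; generalize (n%:R^-1 * ent mu (name a f n)) => z; lra.
Qed.
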